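(* Fix $\gamma>0$. Let $(V_M)_{M\ge1}$ be a sequence of finite-dimensional subspaces of $L^2(\mu)$ (not necessarily contained in $L^2_0(\mu)$), let $\Pi_M$ be the orthogonal projector onto $V_M$, set $V_{M,0}=V_M\cap L_0^2(\mu)$ with associated orthogonal projector $\Pi_{M,0}$, and $u_M=\Pi_M\mathbf 1/\|\Pi_M\mathbf 1\|$. Assume that $$\big\|(A+A^* )(1-\Pi_M)\mathcal L\,\Pi_M\big\|\xrightarrow[M\to\infty]{}0\qquad\text{and}\qquad\|\mathcal L^*u_M\|\xrightarrow[M\to\infty]{}0 .$$ Then there exist $C\ge1$ (independent of $M$ and $\gamma$) and $M_0\ge1$ such that, for any $M\ge M_0$, the operator $\Pi_{M,0}\mathcal L\Pi_{M,0}$ is invertible on $V_{M,0}$ and there is $\widehat\lambda_{\gamma,M}>0$ for which $$\big\|(\Pi_{M,0}\mathcal L\Pi_{M,0})^{-1}\big\|_{\mathcal B(V_{M,0})}\le\frac{C}{\widehat\lambda_{\gamma,M}},$$ with $\widehat\lambda_{\gamma,M}\to\lambda_\gamma>0$ as $M\to\infty$. If in addition $\mathcal L_{\mathrm{FD}}$ stabilizes $V_M$ (in the sense that $\Pi_M\mathcal L_{\mathrm{FD}}=\mathcal L_{\mathrm{FD}}\Pi_M$), then there exist $M_*\ge1$ (independent of $\gamma$) and real numbers $\overline\lambda_M$ (independent of $\gamma$) with $\overline\lambda_M\to\overline\lambda$ as $M\to\infty$ such that, for any $M\ge M_*$, $$\forall\gamma>0,\qquad\widehat\lambda_{\gamm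a,M}\ge\overline\lambda_M\min(\gamma,\gamma^{-1}).$$
   Context: Setting. $D\ge 1$ is an integer; the position space $\mathcal D$ is either a torus $(a\mathbb T)^D$, $\mathbb T=\mathbb R/\mathbb Z$, $a>0$, or $\mathbb R^D$; $\beta,m,\gamma>0$; $V:\mathcal D\to\mathbb R$ is smooth with $\mathrm e^{-\beta V}$ integrable. Probability measures: $\mu(dq\,dp)=Z_\mu^{-1}\mathrm e^{-\beta(V(q)+|p|^2/(2m))}dq\,dp$ on $\mathcal D\times\mathbb R^D$, with marginals $\nu(dq)=Z_\nu^{-1}\mathrm e^{-\beta V(q)}dq$ and $\kappa(dp)=(\beta/(2\pi m))^{D/2}\mathrm e^{-\beta|p|^2/(2m)}dp$. $\langle\cdot,\cdot\rangle$ and $\|\cdot\|$ are the scalar product and norm of $L^2(\mu)$, also $\|\cdot\|$ denotes the operator norm on $L^2(\mu)$; $\mathcal B(E)$ is the space of bounded operators on $E$ with its operator norm; $^*$ is the adjoint on $L^2(\mu)$; $\mathbf 1$ is the constant function equal to 1. $L_0^2(\mu)=\{\varphi\in L^2(\mu):\int\varphi\,d\mu=0\}$, and $\Pi_0\varphi=\varphi-\int\varphi\,d\mu$. Standing assumption on $V$: there is $C_\nu>0$ with $\|\varphi-\int\varphi\,d\nu\|_{L^2(\nu)}^2\le C_\nu^{-1}\|\nabla_q\varphi\|^2_{L^2(\nu)}$ for all $\varphi\in H^1(\nu)$, and there are $c_1>0$, $c_2\in[0,1)$, $c_3>0$ with $\Delta V\le c_1+\frac{c_2}{2}|\nabla V|^2$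 and $|\nabla^2V|\le c_3(1+|\nabla V|)$. Operators: $\mathcal L=\mathcal L_{\mathrm{ham}}+\gamma\mathcal L_{\mathrm{FD}}$ (generator of the Langevin dynamics, a closed operator on $L^2(\mu)$), with $\mathcal L_{\mathrm{ham}}=\frac{p}{m}\cdot\nabla_q-\nabla V\cdot\nabla_p$ and $\mathcal L_{\mathrm{FD}}=-\frac pm\cdot\nabla_p+\frac1\beta\Delta_p$; $\mathcal L^*=-\mathcal L_{\mathrm{ham}}+\gamma\mathcal L_{\mathrm{FD}}$. $(\Pi_p\varphi)(q)=\int_{\mathbb R^D}\varphi(q,p)\,\kappa(dp)$. The bounded operator $A$ is $A=\big(1+(\mathcal L_{\mathrm{ham}}\Pi_p)^*(\mathcal L_{\mathrm{ham}}\Pi_p)\big)^{-1}(\mathcal L_{\mathrm{ham}}\Pi_p)^*$. The elements of $V_M$ are assumed regular enough (in the domains of $\mathcal L$, $\mathcal L^*$, $\mathcal L_{\mathrm{ham}}$, $\mathcal L_{\mathrm{FD}}$) for all expressions to be defined, and $\Pi_M\mathbf 1\neq0$. Constants (from known hypocoercivity results). There exist $\overline\varepsilon\in(0,1)$, $\overline\lambda>0$ and, for each $\gamma>0$, $\widetilde\lambda_\gamma>0$ such that, with $\varepsilon=\overline\varepsilon\min(\gamma,\gamma^{-1})$, for all $\varphi\in\Pi_0C_c^\infty(\mathcal D\times\mathbb R^D)$, $$\langle-\mathcal L\varphi,\varphi\rangle+\varepsilon\langle A\mathcal L\varphi,\varphi\rangle+\varepsilon\langle A\varphi,\mathcal L\varphi\rangle\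 \ge\ \widetilde\lambda_\gamma\|\varphi\|^2 .$$ These are fixed, and $\lambda_\gamma:=\widetilde\lambda_\gamma/(1+\varepsilon)$, with $\lambda_\gamma\ge\overline\lambda\min(\gamma,\gamma^{-1})$. The rate $\lambda_\gamma$ is the one for which $\|\mathrm e^{t\mathcal L}\varphi\|\le C\mathrm e^{-\lambda_\gamma t}\|\varphi\|$ for all $\varphi\in L_0^2(\mu)$, $t\ge0$, with $C$ independent of $\gamma$. *)

(* Defs.v *)
From HB Require Import structures.
From mathcomp Require Import all_boot all_order all_algebra.
From mathcomp Require Import all_classical all_reals all_analysis.

Set Implicit Arguments.
Unset Strict Implicit.
Unset Printing Implicit Defensive.

Import Order.TTheory GRing.Theory Num.Theory.
Import numFieldNormedType.Exports.

Local Open Scope classical_set_scope.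
Local Open Scope ring_scope.

(** ** Lebesgue measure on R^n *)

Fact rV_display : measure_display. Proof. exact: default_measure_display. Qed.

Section rV_measurable.
Context (R : realType) (n : nat).

Definition rV_coord (i : 'I_n) (x : 'rV[R]_n) : measurableTypeR R := x ord0 i.

Let rV_set0 : g_sigma_preimage rV_coord set0.
Proof. exact: sigma_algebra0. Qed.

Let rV_setC A : g_sigma_preimage rV_coord A -> g_sigma_preimage rV_coord (~` A).
Proof. exact: sigma_algebraC. Qed.

Let rV_bigcup (F : (set 'rV[R]_n)^nat) :
  (forall i, g_sigma_preimage rV_coord (F i)) ->
  g_sigma_preimage rV_coord (\bigcup_i (F i)).
Proof. exact: sigma_algebra_bigcup. Qed.

(* Generated by the coordinates, hence the Borel sigma-algebra of R^n. *)
HB.instance Definition _ := @isMeasurable.Build rV_display 'rV[R]_n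
  (g_sigma_preimage rV_coord) rV_set0 rV_setC rV_bigcup.

Lemma measurable_rV_coord i : measurable_fun [set: 'rV[R]_n] (rV_coord i).
Proof.
move=> _ Y mY; rewrite setTI; apply: sub_sigma_algebra => /=.
rewrite -bigcup_seq/=; exists i => /=; first by rewrite mem_index_enum.
by exists Y => //; rewrite setTI.
Qed.

Lemma measurable_fun_rV d (T : measurableType d) (f : T -> 'rV[R]_n) :
  (forall i, measurable_fun [set: T] (rV_coord i \o f)) ->
  measurable_fun [set: T] f.
Proof.
move=> mf.
have sub : g_sigma_preimage (fun i => rV_coord i \o f) `<=` measurable.
  apply: smallest_sub; first exact: sigma_algebra_measurable.
  move=> A; rewrite -bigcup_seq => -[i _] [B mB <-]; exact: mf.
move=> _ A mA; apply: sub.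
by rewrite (g_sigma_preimage_comp rV_coord f); exists A.
Qed.

End rV_measurable.

Section rV_lebesgue.
Context (R : realType).

Definition rV_cons n (x : measurableTypeR R * 'rV[R]_n) : 'rV[R]_n.+1 :=
  \row_i (if unlift ord0 i is Some j then x.2 ord0 j else x.1).

Definition rV_uncons n (x : 'rV[R]_n.+1) : measurableTypeR R * 'rV[R]_n :=
  (x ord0 ord0, \row_j x ord0 (lift ord0 j)).

Lemma rV_consK n : cancel (@rV_cons n) (@rV_uncons n).
Proof.
move=> [a v]; congr pair; first by rewrite mxE unlift_none.
by apply/rowP => j; rewrite !mxE liftK.
Qed.

Lemma measurable_rV_cons n : measurable_fun setT (@rV_cons n).
Proof.
apply: measurable_fun_rV => i.
have [j ->|->] := unliftP ord0 i.
  rewrite (_ : _ \o _ = rV_coord j \o snd).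
    by apply: measurableT_comp => //; exact: measurable_rV_coord.
  by apply/funext => x; rewrite /rV_coord/= mxE liftK.
rewrite (_ : _ \o _ = fst); first exact: measurable_fst.
by apply/funext => x; rewrite /rV_coord/= mxE unlift_none.
Qed.

Lemma measurable_rV_uncons n : measurable_fun setT (@rV_uncons n).
Proof.
apply/measurable_fun_pairP; split; first exact: (measurable_rV_coord ord0).
apply: measurable_fun_rV => i.
rewrite (_ : _ \o _ = rV_coord (lift ord0 i)); first exact: measurable_rV_coord.
by apply/funext => x; rewrite /rV_coord/= mxE.
Qed.

Section leb_step.
Context (n : nat) (l : {sigma_finite_measure set 'rV[R]_n -> \bar R}).

Definition leb_step : set 'rV[R]_n.+1 -> \bar R :=
  pushforward (lebesgue_measure \x l)%E (@rV_cons n).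

Let leb_step0 : leb_step set0 = 0%E.
Proof. by rewrite /leb_step /pushforward preimage_set0 measure0. Qed.

Let leb_step_ge0 A : (0 <= leb_step A)%E.
Proof. by rewrite /leb_step /pushforward; exact: measure_ge0. Qed.

Let leb_step_sigma_additive : semi_sigma_additive leb_step.
Proof.
move=> F mF tF mUF; rewrite /leb_step /pushforward preimage_bigcup.
apply: measure_semi_sigma_additive.
- by move=> k; rewrite -[X in measurable X]setTI; exact: measurable_rV_cons.
- apply/trivIsetP => /= i j _ _ ij; rewrite -preimage_setI.
  by move/trivIsetP : tF => /(_ _ _ _ _ ij) ->//; rewrite preimage_set0.
- rewrite -preimage_bigcup -[X in measurable X]setTI.
  exact: measurable_rV_cons.
Qed.

HB.instance Definition _ := isMeasure.Build _ _ _
  leb_step leb_step0 leb_step_ge0 leb_step_sigma_additive.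

Let leb_step_sigma_finite : sigma_finite setT leb_step.
Proof.
have /sigma_finiteP[F [TF ndF Foo]] := sigma_finiteT (@lebesgue_measure R).
have /sigma_finiteP[G [TG ndG Goo]] := sigma_finiteT l.
exists (fun k => @rV_uncons n @^-1` (F k `*` G k)).
  rewrite -preimage_bigcup (_ : \bigcup_k _ = setT) ?preimage_setT//.
  apply/seteqP; split => // -[x y] _.
  have [i _ Fix] : (\bigcup_k F k) x by rewrite -TF.
  have [j _ Gjy] : (\bigcup_k G k) y by rewrite -TG.
  exists (maxn i j) => //; split.
  - by move: x Fix; exact/subsetPset/ndF/leq_maxl.
  - by move: y Gjy; exact/subsetPset/ndG/leq_maxr.
move=> k; have [mF Flt] := Foo k; have [mG Glt] := Goo k.
have mFG : measurable (F k `*` G k) by exact: measurableX.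
split; first by rewrite -[X in measurable X]setTI; exact: measurable_rV_uncons.
rewrite /leb_step /pushforward (_ : _ @^-1` _ = F k `*` G k).
  by rewrite product_measure1E// lte_mul_pinfty// ge0_fin_numE.
rewrite -comp_preimage (_ : _ \o _ = id) ?preimage_id//.
by apply/funext => x; exact: rV_consK.
Qed.

HB.instance Definition _ := Measure_isSigmaFinite.Build _ _ _
  leb_step leb_step_sigma_finite.

End leb_step.

(* Lebesgue measure on R^n, as the n-fold product of the one on R. *)
Fixpoint leb n : {sigma_finite_measure set 'rV[R]_n -> \bar R} :=
  match n with
  | 0 => [the {sigma_finite_measure set 'rV[R]_0 -> \bar R}
          of \d_(0 : 'rV[R]_0)]
  | k.+1 => [the {sigma_finite_measure set 'rV[R]_k.+1 -> \bar R}
             of leb_step (leb k)]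
  end.

End rV_lebesgue.

(* P has a density proportional to w on S, with respect to the measure m. *)
Definition normalized_density d (T : measurableType d) (R : realType)
    (P : probability T R) (m : {measure set T -> \bar R}) (S : set T)
    (w : T -> R) : Prop :=
  forall A, measurable A ->
    P A = (((\int[m]_(x in S) w x)%R^-1)%:E
            * \int[m]_(x in A `&` S) (w x)%:E)%E.

(** ** L^2 spaces and unbounded operators *)

Section hilbert.
Context d (T : measurableType d) (R : realType) (mu : probability T R).

(* The space of square-integrable functions, before quotienting by equality
   almost everywhere: equality in L^2 is [f = g %[ae mu]]. *)
Definition L2 := LfunType mu (lee1n 2).

Definition dotp (f g : L2) : R := \int[mu]_x (f x * g x).
Definition norm2 (f : L2) : R := Num.sqrt (dotp f f).
Definition one2 : L2 := Lfun_Sub (lee1n 2) (Lfun_cst mu 1 2).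
Definition mean (f : L2) : R := \int[mu]_x f x.
Definition L20 : set L2 := [set f | mean f = 0].
Definition Pi0 (f : L2) : L2 := f - mean f *: one2.

(* A (possibly unbounded, partially defined) operator is given by its graph:
   [G f g] means that f is in the domain of G and G f = g. *)
Definition oper := L2 -> L2 -> Prop.

Definition op_graph (F : L2 -> L2) : oper := fun f g => g = F f %[ae mu].
Definition op_comp (G F : oper) : oper := fun f h => exists2 g, F f g & G g h.
Definition op_id_add (G : oper) : oper :=
  fun f g => exists2 h, G f h & g = f + h %[ae mu].
Definition op_id_sub (G : oper) : oper :=
  fun f g => exists2 h, G f h & g = f - h %[ae mu].
Definition op_inv (G : oper) : oper := fun f g => G g f.
Definition op_adj (G : oper) : oper :=
  fun f g => forall u v, G u v -> dotp v f = dotp u g.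
Definition op_closure (G : oper) : oper := fun f g =>
  exists fn gn : nat -> L2, [/\ forall n, G (fn n) (gn n),
    (norm2 (fn n - f) @[n --> \oo] --> 0) &
    (norm2 (gn n - g) @[n --> \oo] --> 0)].

Definition op_norm (G : oper) : \bar R :=
  ereal_sup [set z | exists f g, [/\ G f g, norm2 f <= 1 & z = (norm2 g)%:E]].

Definition findim_subspace (V : set L2) := exists (n : nat) (e : 'I_n -> L2),
  forall f, V f <-> exists c : 'I_n -> R, f = \sum_i c i *: e i %[ae mu].

Definition oproj (V : set L2) : oper :=
  fun f g => V g /\ forall v, V v -> dotp (f - g) v = 0.

(* G defines an everywhere-defined, single-valued operator on V with a
   two-sided inverse V -> V. *)
Definition invertible_on (V : set L2) (G : oper) : Prop :=
  [/\ forall f, V f -> exists2 g, V g & G f g,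
      forall f g g', V f -> G f g -> G f g' -> g = g' %[ae mu],
      forall g, V g -> exists2 f, V f & G f g &
      forall f f' g, V f -> V f' -> G f g -> G f' g -> f = f' %[ae mu]].

Definition op_restr (V : set L2) (G : oper) : oper :=
  fun f g => [/\ V f, V g & G f g].

End hilbert.

(** ** The position space and its smooth functions *)

(* A function on the torus (aT)^D is a function on R^D that is a-periodic in
   each coordinate; integrals over the torus are taken over [0, a)^D. *)
Inductive position_space (R : realType) := Torus of R | Euclidean.
Arguments Euclidean {R}.

Section position_space.
Context (R : realType) (D : nat) (X : position_space R).
Local Notation vec := 'rV[R]_D.
Local Notation phase := ('rV[R]_D * 'rV[R]_D)%type.

Definition wf_space : Prop := if X is Torus a then 0 < a else True.

Definition cell : set vec :=
  if X is Torus a then [set q | forall i, 0 <= q ord0 i < a] else setT.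

Definition ebase (i : 'I_D) : vec := delta_mx ord0 i.

Definition is_periodic (Y : Type) (f : vec -> Y) : Prop :=
  if X is Torus a then forall q i, f (q + a *: ebase i) = f q else True.

Definition pos_bounded (M : R) (q : vec) : Prop :=
  if X is Torus _ then True else `|q| <= M.

(* All iterated directional derivatives exist and are continuous. *)
Definition smooth (U : normedModType R) (f : U -> R) : Prop :=
  forall s : seq U, let g := foldr (fun v h => 'D_v h) f s in
    continuous g /\ forall x v, derivable g x v.

Definition test_pos (f : vec -> R) : Prop :=
  [/\ smooth f, is_periodic f & exists M, forall q, f q != 0 -> pos_bounded M q].

Definition test_phase (f : phase -> R) : Prop :=
  [/\ smooth f, is_periodic (fun q p => f (q, p)) &
      exists M, forall q p, f (q, p) != 0 -> pos_bounded M q /\ `|p| <= M].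

Definition sqnorm (x : vec) : R := \sum_i (x ord0 i) ^+ 2.

Definition partial (i : 'I_D) (f : vec -> R) : vec -> R := 'D_(ebase i) f.
Definition dq (i : 'I_D) (f : phase -> R) : phase -> R := 'D_(ebase i, 0) f.
Definition dp (i : 'I_D) (f : phase -> R) : phase -> R := 'D_(0, ebase i) f.

Definition sqgrad (V : vec -> R) q : R := \sum_i (partial i V q) ^+ 2.
Definition laplacian (V : vec -> R) q : R := \sum_i partial i (partial i V) q.
(* Frobenius norm; any other norm only changes the constant c3 below. *)
Definition hess_norm (V : vec -> R) q : R :=
  Num.sqrt (\sum_i \sum_j (partial i (partial j V) q) ^+ 2).

Definition weak_gradient (nu : probability vec R) (f : L2 nu)
    (G : 'I_D -> L2 nu) : Prop :=
  forall i psi, test_pos psi ->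
    \int[leb R D]_(q in cell) (f q * partial i psi q) =
    - \int[leb R D]_(q in cell) (G i q * psi q).

(* H^1(nu) is the set of f in L^2(nu) having a weak gradient in L^2(nu). *)
Definition poincare (nu : probability vec R) (Cnu : R) : Prop :=
  forall (f : L2 nu) (G : 'I_D -> L2 nu), weak_gradient f G ->
    norm2 (Pi0 f) ^+ 2 <= Cnu^-1 * \sum_i norm2 (G i) ^+ 2.

Definition potential_bounds (V : vec -> R) (c1 c2 c3 : R) : Prop :=
  forall q, laplacian V q <= c1 + c2 / 2 * sqgrad V q /\
            hess_norm V q <= c3 * (1 + Num.sqrt (sqgrad V q)).

End position_space.

(** ** Langevin dynamics *)

Section langevin.
Context (R : realType) (D : nat) (X : position_space R) (beta m : R)
  (V : 'rV[R]_D -> R).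
Local Notation vec := 'rV[R]_D.
Local Notation phase := ('rV[R]_D * 'rV[R]_D)%type.

Definition gibbs_measure (mu : probability phase R) : Prop :=
  normalized_density mu (leb R D \x leb R D)%E (cell X `*` setT)
    (fun x => expR (- beta * (V x.1 + sqnorm x.2 / (2 * m)))).

Definition gibbs_position (nu : probability vec R) : Prop :=
  normalized_density nu (leb R D) (cell X) (fun q => expR (- beta * V q)).

Definition maxwellian (kappa : probability vec R) : Prop :=
  forall A, measurable A -> kappa A = (\int[leb R D]_(p in A)
    ((beta / (2 * pi * m)) `^ (D%:R / 2)
       * expR (- beta * sqnorm p / (2 * m)))%:E)%E.

Definition ham_expr (f : phase -> R) : phase -> R := fun x =>
  \sum_i (x.2 ord0 i / m * dq i f x - partial i V x.1 * dp i f x).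

Definition fd_expr (f : phase -> R) : phase -> R := fun x =>
  \sum_i (- (x.2 ord0 i / m) * dp i f x + beta^-1 * dp i (dp i f) x).

Definition langevin_expr (gamma : R) (f : phase -> R) : phase -> R := fun x =>
  ham_expr f x + gamma * fd_expr f x.

Context (mu : probability phase R) (kappa : probability vec R).

(* The closed operator of L^2(mu) attached to a differential expression P is
   the closure of P acting on C_c^oo, which is a core for the generator. *)
Definition op_of_expr (P : (phase -> R) -> phase -> R) : oper mu :=
  op_closure (fun f g => test_phase X f /\ forall x, g x = P f x).

Definition Lham : oper mu := op_of_expr ham_expr.
Definition LFD : oper mu := op_of_expr fd_expr.
Definition L (gamma : R) : oper mu := op_of_expr (langevin_expr gamma).
Definition Lstar (gamma : R) : oper mu := op_adj (L gamma).

Definition Pip : oper mu := fun f g =>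
  {ae mu, forall x, g x = \int[kappa]_p f (x.1, p)}.

Definition LhamPip : oper mu := op_comp Lham Pip.

(* The expression (1 + S^* S)^-1 S^*, with S = LhamPip, is defined on the
   domain of S^*, which is dense: A is its bounded extension to L^2(mu). *)
Definition is_A (A : L2 mu -> L2 mu) : Prop :=
  forall f g,
    op_closure (op_comp (op_inv (op_id_add (op_comp (op_adj LhamPip) LhamPip)))
                        (op_adj LhamPip)) f g
    <-> op_graph A f g.

Definition is_adjoint (A As : L2 mu -> L2 mu) : Prop :=
  forall f g, dotp (A f) g = dotp f (As g).

(* L acts on the smooth function f = Pi0 phi through its expression. *)
Definition hypocoercive (A : L2 mu -> L2 mu) (gamma eps lam : R) : Prop :=
  forall phi g : L2 mu, test_phase X phi ->
    let f := Pi0 phi in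
    (forall x, g x = langevin_expr gamma f x) ->
    lam * norm2 f ^+ 2 <=
      dotp (- g) f + eps * dotp (A g) f + eps * dotp (A f) g.

(** ** Galerkin discretization *)

Implicit Type W : set (L2 mu).

(* W is contained in the domains of Lham, LFD, L and L^*, on which
   L = Lham + gamma LFD and L^* = - Lham + gamma LFD. *)
Definition regular (gamma : R) W : Prop := forall f, W f ->
  [/\ exists h, Lham f h, exists k, LFD f k &
      forall h k, Lham f h -> LFD f k ->
        L gamma f (h + gamma *: k) /\ Lstar gamma f (- h + gamma *: k)].

Definition normalized_one W (u : L2 mu) : Prop :=
  exists2 w, oproj W (one2 mu) w & u = (norm2 w)^-1 *: w %[ae mu].

Definition mean_zero W : set (L2 mu) := W `&` @L20 _ _ _ mu.

Definition compression gamma W : oper mu :=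
  op_comp (oproj W) (op_comp (L gamma) (oproj W)).

(* ||(A + A^* )(1 - Pi_M) L Pi_M|| --> 0 and ||L^* u_M|| --> 0. *)
Definition consistent (A As : L2 mu -> L2 mu) (gamma : R)
    (W : nat -> set (L2 mu)) : Prop :=
  (op_norm (op_comp (op_graph (fun f => A f + As f))
     (op_comp (op_id_sub (oproj (W M))) (op_comp (L gamma) (oproj (W M)))))
   @[M --> \oo] --> 0%E) /\
  exists u Lu : nat -> L2 mu,
    (forall M, (0 < M)%N ->
       normalized_one (W M) (u M) /\ Lstar gamma (u M) (Lu M)) /\
    (norm2 (Lu M) @[M --> \oo] --> 0).

(* The compression of L to W `&` L^2_0 is invertible there, and its inverse has
   operator norm at most b. *)
Definition inverse_bound (gamma : R) W (b : R) : Prop :=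
  invertible_on (mean_zero W) (compression gamma (mean_zero W)) /\
  (op_norm (op_inv (op_restr (mean_zero W) (compression gamma (mean_zero W))))
   <= b%:E)%E.

(* Pi_W LFD = LFD Pi_W on the domain of LFD. *)
Definition stabilizes W : Prop :=
  forall f g, op_comp (oproj W) LFD f g -> op_comp LFD (oproj W) f g.

End langevin.

(* Main.v *)
(* The modified scalar product (1 + eps (A + A^* )) makes - L coercive on mean-zero
   functions. For f in W of mean zero, split L f into Pi_0 L f, its component
   <f, L^* u> u on the normalized projection u of 1, and (1 - Pi) L f. The last two
   are small by consistency, so coercivity survives for the compression with rate
   (ltilde - eps (delta + delta)) / (1 + eps), and |A|, |A^*| <= 1/2 gives the inverse
   bound with C = 1. When L_FD commutes with Pi, it maps W to itself and kills Pi 1,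
   because L_FD 1 = 0 (by smooth cut-offs of 1). Hence (1 - Pi) L f and <u, L f> do not
   depend on gamma, and delta can be taken from a single gamma. *)
Require Import Defs.
From HB Require Import structures.
From mathcomp Require Import all_boot all_order all_algebra.
From mathcomp Require Import all_classical all_reals all_analysis.
From mathcomp Require Import measurable_realfun ring lra.

Set Implicit Arguments.
Unset Strict Implicit.
Unset Printing Implicit Defensive.

Import Order.TTheory GRing.Theory Num.Theory.
Import numFieldNormedType.Exports.

Local Open Scope classical_set_scope.
Local Open Scope ring_scope.

(** * The semi-inner product of L^2 *)

(** Three obstacles shape the proof. Operators are graphs, and [L] is a closure that is not known
    here to be single-valued or linear. An image of [f] therefore enters only through its pairings
    with elements of W, where regularity provides an adjoint and makes these pairings depend on [f]
    alone. Equality is almost everywhere and spanning families may be dependent, so linear algebra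
    runs on row spaces of Gram matrices, not on bases. The hypocoercive inequality is given on test
    functions only: it is rewritten so that [A] and its adjoint act on [f] and never on [L f], after
    which every term is continuous along the graph and the inequality passes to the closure. The
    defect along u arises because W need not contain 1. The mean-zero part of W is the orthogonal
    complement of Pi 1 in W, so projecting onto it drops one component that the truncation defect
    does not see. A single delta bounds both defects, whence [delta + delta]. *)

Section semi_inner_product.
Context d (T : measurableType d) (R : realType) (mu : probability T R).
Local Notation E := (L2 mu).
Implicit Types (f g h : E) (a : R).

Lemma dotp_integrable f g : mu.-integrable setT (EFin \o (fun x => f x * g x)).
Proof. by apply/Lfun1_integrable; exact: (Lfun2_mul_Lfun1 (LfunP f) (LfunP g)). Qed.

Lemma dotpC f g : dotp f g = dotp g f.
Proof. by apply: eq_Rintegral => x _; rewrite mulrC. Qed.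

Lemma dotpDl f g h : dotp (f + g) h = dotp f h + dotp g h.
Proof.
rewrite /dotp -RintegralD //; [|exact: dotp_integrable..].
by apply: eq_Rintegral => x _ /=; rewrite mulrDl.
Qed.

Lemma dotpZl a f h : dotp (a *: f) h = a * dotp f h.
Proof.
rewrite /dotp -RintegralZl //; last exact: dotp_integrable.
by apply: eq_Rintegral => x _ /=; rewrite mulrA.
Qed.

Lemma dotpNl f h : dotp (- f) h = - dotp f h.
Proof. by rewrite -scaleN1r dotpZl mulN1r. Qed.

Lemma dotpBl f g h : dotp (f - g) h = dotp f h - dotp g h.
Proof. by rewrite dotpDl dotpNl. Qed.

Lemma dotpDr f g h : dotp h (f + g) = dotp h f + dotp h g.
Proof. by rewrite dotpC dotpDl !(dotpC h). Qed.

Lemma dotpZr a f h : dotp h (a *: f) = a * dotp h f.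
Proof. by rewrite dotpC dotpZl (dotpC h). Qed.

Lemma dotpNr f h : dotp h (- f) = - dotp h f.
Proof. by rewrite dotpC dotpNl (dotpC h). Qed.

Lemma dotpBr f g h : dotp h (f - g) = dotp h f - dotp h g.
Proof. by rewrite dotpDr dotpNr. Qed.

Lemma dotp0l h : dotp 0 h = 0.
Proof. by rewrite -(scale0r 0) dotpZl mul0r. Qed.

Lemma dotp_suml n (e : 'I_n -> E) h : dotp (\sum_i e i) h = \sum_i dotp (e i) h.
Proof.
elim/big_rec2: _ => [|i x y _ <-]; first exact: dotp0l.
exact: dotpDl.
Qed.

Lemma dotp_ge0 f : 0 <= dotp f f.
Proof. by apply: Rintegral_ge0 => x _; rewrite -expr2 sqr_ge0. Qed.

Lemma norm2_ge0 f : 0 <= norm2 f.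
Proof. exact: sqrtr_ge0. Qed.

Lemma norm2_sqr f : norm2 f ^+ 2 = dotp f f.
Proof. by rewrite sqr_sqrtr// dotp_ge0. Qed.

Lemma le_norm2 f a : 0 <= a -> dotp f f <= a ^+ 2 -> norm2 f <= a.
Proof. by move=> a0 le; rewrite -(@ler_pXn2r _ 2) ?nnegrE ?norm2_ge0// norm2_sqr. Qed.

Lemma dotp_norm_le f g : `|dotp f g| <= norm2 f * norm2 g.
Proof.
have nf := norm2_ge0 f; have ng := norm2_ge0 g.
rewrite -(@ler_pXn2r _ 2) ?nnegrE ?mulr_ge0// real_normK ?num_real// exprMn !norm2_sqr.
have ff := dotp_ge0 f; have gg := dotp_ge0 g.
have key t : 0 <= dotp f f + t * (2 * dotp f g) + t ^+ 2 * dotp g g.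
  have := dotp_ge0 (f + t *: g).
  rewrite dotpDl !dotpDr !dotpZl !dotpZr (dotpC g f).
  by congr (0 <= _); ring.
(* The form is only semi-definite: for a null [g] the quadratic in t is affine, and the t chosen
   below would give it the value -1. *)
have [g0|g0] := eqVneq (dotp g g) 0.
  suff -> : dotp f g = 0 by rewrite expr0n mulr_ge0.
  apply/eqP; apply: contraT => fg0.
  have := key (- (dotp f f + 1) / (2 * dotp f g)); rewrite g0 mulr0 addr0.
  by rewrite divfK ?mulf_neq0// => ?; exfalso; lra.
have gp : 0 < dotp g g by rewrite lt_neqAle eq_sym g0.
(* The minimizer of the quadratic; its minimum is the Cauchy-Schwarz defect divided by
   [dotp g g]. *)
have := key (- dotp f g / dotp g g).
set t := _ / _ => kt; rewrite -subr_ge0.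
suff -> : dotp f f * dotp g g - dotp f g ^+ 2 =
    dotp g g * (dotp f f + t * (2 * dotp f g) + t ^+ 2 * dotp g g).
  by rewrite mulr_ge0.
by rewrite /t; field.
Qed.

Lemma dotp_le f g : dotp f g <= norm2 f * norm2 g.
Proof. exact: le_trans (ler_norm _) (dotp_norm_le f g). Qed.

Lemma norm2D f g : norm2 (f + g) <= norm2 f + norm2 g.
Proof.
apply: le_norm2; first by rewrite addr_ge0 ?norm2_ge0.
rewrite dotpDl !dotpDr (dotpC g f) -!norm2_sqr.
by have := dotp_le f g; lra.
Qed.

Lemma norm2Z a f : norm2 (a *: f) = `|a| * norm2 f.
Proof. by rewrite /norm2 dotpZl dotpZr mulrA -expr2 sqrtrM ?sqr_ge0// sqrtr_sqr. Qed.

Lemma norm2N f : norm2 (- f) = norm2 f.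
Proof. by rewrite -scaleN1r norm2Z normrN1 mul1r. Qed.

Lemma norm2B f g : norm2 (f - g) <= norm2 f + norm2 g.
Proof. by rewrite (le_trans (norm2D _ _))// norm2N. Qed.

Lemma norm2_distC f g : norm2 (f - g) = norm2 (g - f).
Proof. by rewrite -norm2N opprB. Qed.

Lemma norm2_0 : norm2 (0 : E) = 0.
Proof. by rewrite /norm2 dotp0l sqrtr0. Qed.

Lemma dotp_null g f : norm2 f = 0 -> dotp f g = 0.
Proof.
move=> f0; apply/eqP; rewrite -normr_le0.
by rewrite (le_trans (dotp_norm_le f g))// f0 mul0r.
Qed.

(** The square of f - g is nonnegative and measurable, so its integral vanishes exactly when it is
    null almost everywhere. This turns the equalities of the definitions into seminorm
    computations. *)
Lemma ae_eq_norm2 f g : f = g %[ae mu] <-> norm2 (f - g) = 0.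
Proof.
have mf : measurable_fun setT (fun x => (f - g) x).
  by have := LfunP (f - g); rewrite inE/= => /andP[/[!inE]].
have E1 : (\int[mu]_x `|((f - g)%R x * (f - g)%R x)%:E| = (dotp (f - g) (f - g))%:E)%E.
  rewrite /dotp /Rintegral fineK.
    by apply: eq_integral => x _; rewrite gee0_abs// lee_fin -expr2 sqr_ge0.
  by apply: integrable_fin_num => //; exact: dotp_integrable.
have /measurable_EFinP E2 : measurable_fun setT (fun x => (f - g) x * (f - g) x).
  exact: measurable_funM.
have := @ae_eq_integral_abs _ _ _ mu setT measurableT _ E2.
rewrite E1 => H; split=> [fg|fg0].
  have : dotp (f - g) (f - g) = 0.
    apply/EFin_inj/H; apply: filterS fg => x /(_ I) + _.
    by move=> e; congr EFin; change ((f x - g x) * (f x - g x) = 0); rewrite e subrr mulr0.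
  by rewrite /norm2 => ->; rewrite sqrtr0.
have /H : (dotp (f - g) (f - g))%:E = 0%E by rewrite -norm2_sqr fg0 expr0n.
apply: filterS => x /(_ I) [] /eqP + _.
by rewrite mulf_eq0 orbb => /eqP fg; apply/eqP; rewrite -subr_eq0; exact/eqP.
Qed.

Lemma ae_eq_0 f : f = 0 %[ae mu] <-> norm2 f = 0.
Proof. by rewrite (ae_eq_norm2 f 0) subr0. Qed.

Lemma dotp_aeP f g : (forall h, dotp f h = dotp g h) -> f = g %[ae mu].
Proof.
move=> fg; apply/ae_eq_norm2; rewrite /norm2 dotpBl fg subrr.
exact: sqrtr0.
Qed.

Lemma ae_dotpl f g h : f = g %[ae mu] -> dotp f h = dotp g h.
Proof. by move=> /ae_eq_norm2 fg; apply/eqP; rewrite -subr_eq0 -dotpBl dotp_null. Qed.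

Lemma ae_dotpr f g h : f = g %[ae mu] -> dotp h f = dotp h g.
Proof. by move=> fg; rewrite !(dotpC h); exact: ae_dotpl. Qed.

Lemma ae_norm2 f g : f = g %[ae mu] -> norm2 f = norm2 g.
Proof. by move=> fg; rewrite /norm2 (ae_dotpl _ fg) (ae_dotpr _ fg). Qed.

Lemma L2_ae_sym f g : f = g %[ae mu] -> g = f %[ae mu].
Proof. by move/ae_eq_norm2 => fg; apply/ae_eq_norm2; rewrite norm2_distC. Qed.

Lemma L2_ae_refl f : f = f %[ae mu].
Proof. by apply/ae_eq_norm2; rewrite subrr norm2_0. Qed.

Lemma L2_ae_trans f g h : f = g %[ae mu] -> g = h %[ae mu] -> f = h %[ae mu].
Proof. by apply: filterS2 => x + + _ => /(_ I) -> /(_ I). Qed.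

Lemma mean_dotp f : mean f = dotp f (one2 mu).
Proof. by apply: eq_Rintegral => x _; rewrite /= mulr1. Qed.

Lemma one2_unit : dotp (one2 mu) (one2 mu) = 1.
Proof.
rewrite /dotp (eq_Rintegral mu (g := cst 1)).
  rewrite Rintegral_cst// mul1r -[RHS]/(fine 1%E); congr fine; exact: probability_setT.
by move=> x _; rewrite /= mulr1.
Qed.

(** The error is expanded around the limits into one quadratic and two linear terms, so no separate
    bound on the sequences is required. *)
Lemma cvg_dotp (fn gn : nat -> E) f g :
  norm2 (fn n - f) @[n --> \oo] --> 0 -> norm2 (gn n - g) @[n --> \oo] --> 0 ->
  dotp (fn n) (gn n) @[n --> \oo] --> dotp f g.
Proof.
move=> fnf gng; apply/subr_cvg0; rewrite /=.
apply: (@squeeze_cvgr _ _ _ _ (fun n => - (norm2 (fn n - f) * norm2 (gn n - g) +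
    norm2 (fn n - f) * norm2 g + norm2 f * norm2 (gn n - g)))
   (fun n => norm2 (fn n - f) * norm2 (gn n - g) +
    norm2 (fn n - f) * norm2 g + norm2 f * norm2 (gn n - g))).
- near=> n; rewrite -ler_norml.
  have -> : dotp (fn n) (gn n) - dotp f g = dotp (fn n - f) (gn n - g) +
      dotp (fn n - f) g + dotp f (gn n - g).
    by rewrite !dotpBl !dotpBr; ring.
  rewrite (le_trans (ler_normD _ _))// lerD ?dotp_norm_le//.
  by rewrite (le_trans (ler_normD _ _))// lerD ?dotp_norm_le.
- rewrite -[X in _ --> X]oppr0; apply: cvgN.
  rewrite -[X in _ --> X]addr0; apply: cvgD.
    rewrite -[X in _ --> X]addr0; apply: cvgD.
      by rewrite -[X in _ --> X](mulr0 0); exact: cvgM.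
    by rewrite -[X in _ --> X](mul0r (norm2 g)); apply: cvgM => //; exact: cvg_cst.
  by rewrite -[X in _ --> X](mulr0 (norm2 f)); apply: cvgM => //; exact: cvg_cst.
- rewrite -[X in _ --> X]addr0; apply: cvgD.
    rewrite -[X in _ --> X]addr0; apply: cvgD.
      by rewrite -[X in _ --> X](mulr0 0); exact: cvgM.
    by rewrite -[X in _ --> X](mul0r (norm2 g)); apply: cvgM => //; exact: cvg_cst.
  by rewrite -[X in _ --> X](mulr0 (norm2 f)); apply: cvgM => //; exact: cvg_cst.
Unshelve. all: by end_near. Qed.

Lemma cvg_norm2_dom (fn gn : nat -> E) f g (k : R) :
  (forall n, norm2 (fn n - f) <= k * norm2 (gn n - g)) ->
  norm2 (gn n - g) @[n --> \oo] --> 0 -> norm2 (fn n - f) @[n --> \oo] --> 0.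
Proof.
move=> le gng.
apply: (@squeeze_cvgr _ _ _ _ (cst 0) (fun n => k * norm2 (gn n - g))).
- by near=> n; rewrite norm2_ge0 le.
- exact: cvg_cst.
- by rewrite -[X in _ --> X](mulr0 k); apply: cvgM => //; exact: cvg_cst.
Unshelve. all: by end_near. Qed.

(** A crude constant from the triangle inequality; only the continuity of [Pi0] is wanted. *)
Lemma norm2_Pi0 f : norm2 (Pi0 f) <= 2 * norm2 f.
Proof.
rewrite /Pi0 mean_dotp (le_trans (norm2B _ _))// norm2Z.
have n1 : norm2 (one2 mu) = 1 by rewrite /norm2 one2_unit sqrtr1.
by rewrite n1; have := dotp_norm_le f (one2 mu); rewrite n1; lra.
Qed.

Lemma Pi0B f g : Pi0 (f - g) = Pi0 f - Pi0 g.
Proof.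
by rewrite /Pi0 !mean_dotp dotpBl scalerBl !opprD !opprK !addrA; congr (_ + _); rewrite addrAC.
Qed.

Lemma cvg_Pi0 (fn : nat -> E) f : norm2 (fn n - f) @[n --> \oo] --> 0 ->
  norm2 (Pi0 (fn n) - Pi0 f) @[n --> \oo] --> 0.
Proof. by apply: (@cvg_norm2_dom _ _ _ _ 2) => n; rewrite -Pi0B norm2_Pi0. Qed.

End semi_inner_product.

(** * Finite-dimensional subspaces *)

Section finite_dimensional.
Context d (T : measurableType d) (R : realType) (mu : probability T R).
Local Notation E := (L2 mu).
Implicit Types (f g h : E) (W : set E).

Definition lin_comb n (e : 'I_n -> E) (c : 'rV[R]_n) : E := \sum_i c 0 i *: e i.

Lemma dotp_lin_comb n (e : 'I_n -> E) c f :
  dotp (lin_comb e c) f = \sum_i c 0 i * dotp (e i) f.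
Proof. by rewrite dotp_suml; apply: eq_bigr => i _; rewrite dotpZl. Qed.

Definition pairing n (v e : 'I_n -> E) : 'M[R]_n := \matrix_(i, j) dotp (v i) (e j).

Lemma mul_pairing n (v e : 'I_n -> E) (c : 'rV[R]_n) :
  c *m pairing v e = \row_j dotp (lin_comb v c) (e j).
Proof.
by apply/rowP => j; rewrite !mxE dotp_lin_comb; apply: eq_bigr => i _; rewrite mxE.
Qed.

Lemma gram_null n (e : 'I_n -> E) (c : 'rV[R]_n) :
  c *m pairing e e = 0 -> norm2 (lin_comb e c) = 0.
Proof.
rewrite mul_pairing => /rowP c0.
rewrite /norm2 dotp_lin_comb big1 ?sqrtr0// => i _.
by have := c0 i; rewrite !mxE dotpC => ->; rewrite mulr0.
Qed.

(** A column of the cokernel of the Gram matrix is a combination of the [e] of zero norm, hence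
    pairs to zero with any f. Membership in the row space replaces inversion of a matrix that may be
    singular. *)
Lemma sub_gram n (e : 'I_n -> E) f : (\row_j dotp f (e j) <= pairing e e)%MS.
Proof.
set G := pairing e e.
have GT : G^T = G by apply/matrixP => i j; rewrite !mxE dotpC.
rewrite submxE; apply/eqP/rowP => k; rewrite !mxE.
have : norm2 (lin_comb e (col k (cokermx G))^T) = 0.
  apply: gram_null; rewrite -/G -[X in _ *m X]GT -trmx_mul colE mulmxA mulmx_coker.
  by rewrite mul0mx trmx0.
move=> /(dotp_null f); rewrite dotp_lin_comb => {2}<-.
by apply: eq_bigr => i _; rewrite !mxE mulrC dotpC.
Qed.

(* Injectivity on the span of e bounds the rank of the pairing from below by
   that of the Gram matrix, while every row of the pairing lies in the row space of
   the Gram matrix: the two row spaces agree. *)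
Lemma pairing_surjective n (e v : 'I_n -> E) :
  (forall c, (forall j, dotp (lin_comb v c) (e j) = 0) -> norm2 (lin_comb e c) = 0) ->
  forall g, exists c, forall j, dotp (lin_comb v c) (e j) = dotp g (e j).
Proof.
move=> inj g; set B := pairing v e; set G := pairing e e.
have BG : (B <= G)%MS.
  apply/row_subP => i.
  have -> : row i B = \row_j dotp (v i) (e j) by apply/rowP => j; rewrite !mxE.
  exact: sub_gram.
have kBG : (kermx B <= kermx G)%MS.
  apply/row_subP => i; apply/sub_kermxP; rewrite mul_pairing.
  have : norm2 (lin_comb e (row i (kermx B))) = 0.
    apply: inj => j.
    have : row i (kermx B) *m B = 0 by rewrite -row_mul mulmx_ker; apply/rowP => k; rewrite !mxE.
    by rewrite mul_pairing => /rowP/(_ j); rewrite !mxE.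
  by move=> n0; apply/rowP => j; rewrite !mxE dotp_null.
have /eqmxP GB : (B == G)%MS.
  rewrite -(geq_leqif (mxrank_leqif_eq BG)).
  move/mxrankS : kBG; rewrite !mxrank_ker.
  by rewrite leq_sub2lE ?rank_leq_row.
have : (\row_j dotp g (e j) <= B)%MS by rewrite GB sub_gram.
case/submxP => c; rewrite mul_pairing => /rowP gc; exists c => j.
by have := gc j; rewrite !mxE.
Qed.

Lemma findim_lin_comb W n (e : 'I_n -> E) :
  (forall f, W f <-> exists c : 'I_n -> R, f = \sum_i c i *: e i %[ae mu]) ->
  (forall c, W (lin_comb e c)) /\ forall f, W f -> exists c, f = lin_comb e c %[ae mu].
Proof.
move=> We; split=> [c|f /We[c fc]].
  by apply/We; exists (fun i => c 0 i); exact: L2_ae_refl.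
exists (\row_i c i); rewrite /lin_comb.
by under eq_bigr do rewrite mxE.
Qed.

Lemma findim_ae W f g : findim_subspace W -> W f -> f = g %[ae mu] -> W g.
Proof.
move=> [n [e We]] /We[c fc] fg; apply/We; exists c.
by apply: L2_ae_trans fc; exact: L2_ae_sym.
Qed.

Lemma L2_aeD f f' g g' : f = f' %[ae mu] -> g = g' %[ae mu] -> f + g = f' + g' %[ae mu].
Proof.
move=> /ae_eq_norm2 fE /ae_eq_norm2 gE; apply/ae_eq_norm2/eqP.
rewrite eq_le norm2_ge0 andbT opprD addrACA.
by rewrite (le_trans (norm2D _ _))// fE gE addr0.
Qed.

Lemma L2_aeZ (a : R) f f' : f = f' %[ae mu] -> a *: f = a *: f' %[ae mu].
Proof.
by move=> /ae_eq_norm2 fE; apply/ae_eq_norm2; rewrite -scalerBr norm2Z fE mulr0.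
Qed.

Lemma L2_aeB f f' g g' : f = f' %[ae mu] -> g = g' %[ae mu] -> f - g = f' - g' %[ae mu].
Proof.
move=> ff gg; rewrite -(scaleN1r g) -(scaleN1r g').
by apply: L2_aeD => //; exact: L2_aeZ.
Qed.

Lemma findimD W f g : findim_subspace W -> W f -> W g -> W (f + g).
Proof.
move=> [n [e We]] /We[c fc] /We[c' gc]; apply/We; exists (fun i => c i + c' i).
under eq_bigr do rewrite scalerDl.
by rewrite big_split; exact: L2_aeD.
Qed.

Lemma findimZ W (a : R) f : findim_subspace W -> W f -> W (a *: f).
Proof.
move=> [n [e We]] /We[c fc]; apply/We; exists (fun i => a * c i).
under eq_bigr do rewrite -scalerA.
by rewrite -scaler_sumr; exact: L2_aeZ.
Qed.

Lemma findimB W f g : findim_subspace W -> W f -> W g -> W (f - g).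
Proof. by move=> fW Wf Wg; rewrite -scaleN1r; apply: findimD => //; exact: findimZ. Qed.

(** By [sub_gram], the normal equations are solvable even for dependent generators. *)
Lemma oproj_exists W f : findim_subspace W -> exists g, oproj W f g.
Proof.
move=> [n [e We]]; have [We1 We2] := findim_lin_comb We.
have /submxP[c] := sub_gram e f; rewrite mul_pairing => /rowP fc.
exists (lin_comb e c); split=> // v /We2[a va].
rewrite (ae_dotpr _ va) dotpC dotp_lin_comb big1// => i _.
by have := fc i; rewrite !mxE => fE; rewrite dotpC dotpBl fE subrr mulr0.
Qed.

Lemma oproj_unique W f g g' : findim_subspace W -> oproj W f g -> oproj W f g' ->
  g = g' %[ae mu].
Proof.
move=> fW [Wg pg] [Wg' pg']; apply/ae_eq_norm2.
have Wgg := findimB fW Wg Wg'.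
(* Both residuals are orthogonal to W, and the difference of the two projections lies in W. *)
rewrite /norm2 {1}(_ : g - g' = (f - g') - (f - g)); last first.
  by rewrite opprB [in RHS]addrC subrKA.
by rewrite dotpBl pg// pg'// subrr sqrtr0.
Qed.

Lemma oproj_id W f : W f -> oproj W f f.
Proof. by split=> // v _; rewrite subrr dotp0l. Qed.

Lemma oproj_ae W f g g' : findim_subspace W -> oproj W f g -> g = g' %[ae mu] -> oproj W f g'.
Proof.
move=> fW [Wg pg] gg'; split; first exact: findim_ae gg'.
move=> v Wv; rewrite dotpBl -(ae_dotpl _ gg') -dotpBl; exact: pg.
Qed.

Lemma oproj_dotp W f g v : oproj W f g -> W v -> dotp g v = dotp f v.
Proof. by move=> [_ +] Wv => /(_ _ Wv)/eqP; rewrite dotpBl subr_eq0 => /eqP. Qed.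

(* [mean_zero] over an arbitrary probability space. *)
Definition zero_mean W : set E := W `&` @L20 _ _ _ mu.

(** * The mean-zero part of a finite-dimensional space *)

Section zero_mean.
Context (W : set E) (w : E) (fW : findim_subspace W) (w1 : oproj W (one2 mu) w)
  (w0 : ~ w = 0 %[ae mu]).

(** For f in W the mean is <f, 1> = <f, w>, because w is the projection of 1 onto W. *)
Lemma zero_meanP f : zero_mean W f <-> W f /\ dotp f w = 0.
Proof.
rewrite /zero_mean /L20 /setI/= mean_dotp.
have e : W f -> dotp f (one2 mu) = dotp f w.
  by move=> Wf; rewrite dotpC -(oproj_dotp w1 Wf) dotpC.
by split=> -[Wf f0]; split=> //; rewrite -f0 e.
Qed.

Lemma norm_proj_one_gt0 : 0 < norm2 w.
Proof.
rewrite lt_neqAle norm2_ge0 andbT eq_sym; apply/eqP => n0.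
by apply: w0; apply/ae_eq_0.
Qed.

Lemma zero_mean_decomp f (u := (norm2 w)^-1 *: w) :
  W f -> zero_mean W (f - dotp f u *: u).
Proof.
move=> Wf; have n0 := norm_proj_one_gt0.
apply/zero_meanP; split.
  by apply: findimB => //; do 2 apply: findimZ => //; exact: w1.1.
rewrite dotpBl dotpZl /u dotpZl dotpZr -norm2_sqr.
by field; rewrite gt_eqF.
Qed.

Lemma zero_mean_orth f (u := (norm2 w)^-1 *: w) : zero_mean W f -> dotp f u = 0.
Proof. by move=> /zero_meanP[_ fw]; rewrite dotpZr fw mulr0. Qed.

(** Removing the component along u from each generator of W gives generators of the mean-zero part;
    their number need not drop, since spanning families may be dependent. *)
Lemma zero_mean_findim : findim_subspace (zero_mean W).
Proof.
have [n [e We]] := fW; pose u := (norm2 w)^-1 *: w.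
have [We1 We2] := findim_lin_comb We.
have We3 i : W (e i).
  apply/We; exists (fun j => (i == j)%:R).
  rewrite (bigD1 i)//= eqxx scale1r big1 ?addr0 => [|j ji]; first exact: L2_ae_refl.
  by rewrite eq_sym (negPf ji) scale0r.
exists n, (fun i => e i - dotp (e i) u *: u) => f.
have sumE (c : 'I_n -> R) : \sum_i c i *: (e i - dotp (e i) u *: u) =
    \sum_i c i *: e i - dotp (\sum_i c i *: e i) u *: u.
  rewrite dotp_suml scaler_suml -sumrB; apply: eq_bigr => i _.
  by rewrite scalerBr dotpZl scalerA.
split=> [Wf|[c fc]].
  have [c fc] := (We f).1 Wf.1.
  by exists c; rewrite sumE -(ae_dotpl u fc) zero_mean_orth// scale0r subr0.
have : zero_mean W (\sum_i c i *: (e i - dotp (e i) u *: u)).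
  by rewrite sumE; apply/zero_mean_decomp/We; exists c; exact: L2_ae_refl.
move=> /zero_meanP[Wc cw]; apply/zero_meanP; split.
  by apply: findim_ae Wc _ => //; exact: L2_ae_sym.
by rewrite (ae_dotpl _ fc).
Qed.

End zero_mean.

End finite_dimensional.

(** * Compression of a coercive operator *)

Section bounded_operators.
Context d (T : measurableType d) (R : realType) (mu : probability T R).
Local Notation E := (L2 mu).
Implicit Types (f g h : E) (G S : oper mu).

Lemma op_closure_ae G f f' g : op_closure G f g -> f = f' %[ae mu] -> op_closure G f' g.
Proof.
move=> [fn [gn [Gn fnf gng]]] ff'; exists fn, gn; split=> //.
under eq_cvg => n.
  rewrite (ae_norm2 (g := fn n - f)); first over.
  apply: L2_aeB; first exact: L2_ae_refl.
  exact: L2_ae_sym.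
exact: fnf.
Qed.

(* With h + S^* S h = S^* f one gets |h|^2 + |S h|^2 = <f, S h> <= |f| |S h|. *)
Lemma regularized_inverse_norm S f h :
  op_comp (op_inv (op_id_add (op_comp (op_adj S) S))) (op_adj S) f h ->
  norm2 h <= 2^-1 * norm2 f.
Proof.
move=> [k Sfk [l [s Shs Ssl] kE]].
have e1 : dotp s f = dotp h k by exact: Sfk.
have e2 : dotp s s = dotp h l by exact: Ssl.
move: e1; rewrite (ae_dotpr _ kE) dotpDr -e2 => e1.
apply: le_norm2; first by rewrite mulr_ge0 ?norm2_ge0 ?invr_ge0.
have := dotp_le s f; rewrite e1 -(norm2_sqr s).
have : 0 <= (norm2 s - 2^-1 * norm2 f) ^+ 2 by exact: sqr_ge0.
by nra.
Qed.

(** [A] is specified as a closure; this carries the bound 1/2 from the unclosed expression to [A]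
    itself. *)
Lemma op_closure_bound G (k : R) : 0 <= k ->
  (forall f g, G f g -> norm2 g <= k * norm2 f) ->
  forall f g, op_closure G f g -> norm2 g <= k * norm2 f.
Proof.
move=> k0 bG f g [fn [gn [Gn fnf gng]]].
apply: le_norm2; first by rewrite mulr_ge0 ?norm2_ge0.
rewrite exprMn norm2_sqr.
have fnfn : k ^+ 2 * dotp (fn n) (fn n) @[n --> \oo] --> k ^+ 2 * dotp f f.
  by apply: cvgM; [exact: cvg_cst|exact: (cvg_dotp fnf fnf)].
apply: (ler_cvg_to (cvg_dotp gng gng) fnfn).
near=> n; rewrite -!norm2_sqr -exprMn ler_pXn2r ?nnegrE ?mulr_ge0 ?norm2_ge0//.
exact: bG.
Unshelve. all: by end_near. Qed.

(** * The symmetric operator A + A^* and closure of the coercive inequality *)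

Section symmetrization.
Context (A As : E -> E) (A_le : forall f, norm2 (A f) <= 2^-1 * norm2 f)
  (AAs : forall f g, dotp (A f) g = dotp f (As g)).

Definition sym_op f : E := A f + As f.

(** Duality: the squared norm of [As f] is <A (As f), f>, at most half the product of the norms of
    [As f] and f. *)
Lemma adjoint_bound f : norm2 (As f) <= 2^-1 * norm2 f.
Proof.
have [->|n0] := eqVneq (norm2 (As f)) 0.
  by rewrite mulr_ge0 ?norm2_ge0 ?invr_ge0.
have np : 0 < norm2 (As f) by rewrite lt_neqAle eq_sym n0 norm2_ge0.
rewrite -(ler_pM2r np) -expr2 norm2_sqr -AAs (le_trans (dotp_le _ _))//.
by rewrite mulrAC ler_wpM2r ?norm2_ge0// A_le.
Qed.

Lemma sym_op_norm f : norm2 (sym_op f) <= norm2 f.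
Proof.
rewrite (le_trans (norm2D _ _))//.
by have := A_le f; have := adjoint_bound f; lra.
Qed.

Lemma sym_opP f g : dotp (sym_op f) g = dotp f (sym_op g).
Proof. by rewrite dotpDl dotpDr AAs addrC (dotpC (As f)) -AAs (dotpC (A g)). Qed.

(** [A] and [As] are functions on representatives, not assumed linear. Symmetry gives additivity of
    [sym_op] almost everywhere, and boundedness then gives continuity. *)
Lemma cvg_sym_op (fn : nat -> E) f : norm2 (fn n - f) @[n --> \oo] --> 0 ->
  norm2 (sym_op (fn n) - sym_op f) @[n --> \oo] --> 0.
Proof.
apply: (@cvg_norm2_dom _ _ _ _ _ _ _ _ 1) => n; rewrite mul1r.
rewrite (le_trans _ (sym_op_norm _))// le_eqVlt; apply/orP; left; apply/eqP.
apply/ae_norm2/dotp_aeP => h.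
by rewrite dotpBl !sym_opP dotpBl.
Qed.

Lemma op_closure_coercive G (lam eps : R) :
  (forall f g, G f g -> lam * norm2 (Pi0 f) ^+ 2 <=
     - dotp g (Pi0 f) + eps * dotp g (sym_op (Pi0 f))) ->
  forall f g, op_closure G f g -> lam * norm2 (Pi0 f) ^+ 2 <=
     - dotp g (Pi0 f) + eps * dotp g (sym_op (Pi0 f)).
Proof.
move=> cG f g [fn [gn [Gn fnf gng]]].
have pf := cvg_Pi0 fnf; have bf := cvg_sym_op pf.
have lhs : lam * dotp (Pi0 (fn n)) (Pi0 (fn n)) @[n --> \oo] -->
    lam * dotp (Pi0 f) (Pi0 f).
  by apply: cvgM; [exact: cvg_cst|exact: (cvg_dotp pf pf)].
have rhs : - dotp (gn n) (Pi0 (fn n)) + eps * dotp (gn n) (sym_op (Pi0 (fn n)))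
    @[n --> \oo] --> - dotp g (Pi0 f) + eps * dotp g (sym_op (Pi0 f)).
  apply: cvgD; first by apply: cvgN; exact: (cvg_dotp gng pf).
  by apply: cvgM; [exact: cvg_cst|exact: (cvg_dotp gng bf)].
rewrite norm2_sqr; apply: (ler_cvg_to lhs rhs).
by near=> n; rewrite -norm2_sqr; exact: cG.
Unshelve. all: by end_near. Qed.

(** * Invertibility of the compression to the mean-zero part *)

Section compression.
Context (Lop : oper mu) (lam eps : R) (eps_ge0 : 0 <= eps)
  (coercive : forall f v, Lop f v -> lam * norm2 (Pi0 f) ^+ 2 <=
     - dotp v (Pi0 f) + eps * dotp v (sym_op (Pi0 f))).
Context (W : set E) (w : E) (fW : findim_subspace W) (w1 : oproj W (one2 mu) w)
  (w0 : ~ w = 0 %[ae mu]).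
Context (domL : forall f, W f -> exists v, Lop f v)
  (domLs : forall f, W f -> exists v, op_adj Lop f v).
Context (delta : R).
Let W0 := zero_mean W.
Let u : E := (norm2 w)^-1 *: w.
Context (truncation : forall f, W0 f -> norm2 f <= 1 -> exists v, [/\ Lop f v,
  forall z, oproj W v z -> norm2 (sym_op (v - z)) <= delta &
  `|dotp v u| <= delta]).

(** An adjoint image of [h] turns both pairings into pairings with f and f'. This stands in for
    single-valuedness of [Lop]. *)
Lemma dotp_image_unique f f' v v' h : W h -> f = f' %[ae mu] ->
  Lop f v -> Lop f' v' -> dotp v h = dotp v' h.
Proof.
by move=> /domLs[hs Lh] ff' fv fv'; rewrite (Lh _ _ fv) (Lh _ _ fv') (ae_dotpl _ ff').
Qed.

(** Stated on the unit sphere because [truncation], like [op_norm], controls only the unit ball.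
    Coercivity is tested at f: the terms in g contribute at most (1 + eps) |g|, the two defects at
    most eps delta each. *)
Lemma compression_lower_bound_unit f v g : W0 f -> norm2 f = 1 -> Lop f v ->
  oproj W0 v g -> lam - eps * (delta + delta) <= (1 + eps) * norm2 g.
Proof.
move=> Wf0 f1 Lfv0 vg0; have [|v' [Lfv tr1 tr2]] := truncation Wf0; first by rewrite f1.
have fW0 : findim_subspace W0 by exact: (zero_mean_findim fW w1 w0).
(* The image [v'] supplied by [truncation] may differ from the given one, but has the same
   projection onto [W0]. *)
have vg : oproj W0 v' g.
  split=> [|h Wh]; first exact: vg0.1.
  rewrite -(vg0.2 _ Wh) !dotpBl; congr (_ - _).
  by apply: (dotp_image_unique Wh.1 _ Lfv Lfv0); exact: L2_ae_refl.
have [z vz] := oproj_exists v' fW.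
have Wu : W u by apply: findimZ => //; exact: w1.1.
(* Projecting onto W and then dropping the component along u amounts to projecting onto [W0]. *)
have zE : z = g + dotp v' u *: u %[ae mu].
  have zu : z - dotp v' u *: u = g %[ae mu].
    apply: (oproj_unique fW0) vg; rewrite -(oproj_dotp vz Wu); split.
      by apply: zero_mean_decomp => //; exact: vz.1.
    move=> h Wh; rewrite !dotpBl dotpZl (oproj_dotp vz Wh.1).
    by rewrite -[dotp u h]dotpC [dotp h u](zero_mean_orth w1)// mulr0 subr0 subrr.
  have := L2_aeD zu (@L2_ae_refl _ _ _ mu (dotp v' u *: u)).
  by rewrite subrK.
have fE : Pi0 f = f by rewrite /Pi0 (_ : mean f = 0) ?scale0r ?subr0//; exact: Wf0.2.
have nu : norm2 u = 1.
  rewrite norm2Z ger0_norm ?invr_ge0 ?norm2_ge0// mulVf// gt_eqF//.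
  exact: norm_proj_one_gt0.
have := coercive Lfv; rewrite fE.
have -> : dotp v' f = dotp g f by rewrite (oproj_dotp vg Wf0).
(* The symmetric operator is moved off [f] in the truncation term only, where consistency controls
   it. *)
have -> : dotp v' (sym_op f) = dotp (sym_op (v' - z)) f + dotp g (sym_op f) +
    dotp v' u * dotp u (sym_op f).
  by rewrite sym_opP -dotpZl -addrA -dotpDl -(ae_dotpl _ zE) -dotpDl subrK.
have ng := norm2_ge0 g.
have b1 : - dotp g f <= norm2 g.
  rewrite -[leRHS]mulr1 -f1 (le_trans _ (dotp_norm_le _ _))//.
  by rewrite -normrN ler_norm.
have b2 : dotp (sym_op (v' - z)) f <= delta.
  by rewrite (le_trans (dotp_le _ _))// f1 mulr1 tr1.
have sf1 : norm2 (sym_op f) <= 1 by rewrite -f1 sym_op_norm.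
have b3 : dotp g (sym_op f) <= norm2 g.
  by rewrite (le_trans (dotp_le _ _))// ler_piMr.
have b4 : dotp v' u * dotp u (sym_op f) <= delta.
  rewrite (le_trans (ler_norm _))// normrM -[leRHS]mulr1 ler_pM//.
  by rewrite (le_trans (dotp_norm_le _ _))// nu mul1r.
have : eps * (dotp (sym_op (v' - z)) f + dotp g (sym_op f) +
    dotp v' u * dotp u (sym_op f)) <= eps * (delta + norm2 g + delta).
  by rewrite ler_wpM2l// !lerD.
by rewrite f1 expr1n; lra.
Qed.

(* L need not be linear as a graph: the normalized f gets its own image, and the
   two are compared through the adjoint, which is defined on all of W. *)
Lemma compression_lower_bound f v g : W0 f -> Lop f v -> oproj W0 v g ->
  (lam - eps * (delta + delta)) * norm2 f <= (1 + eps) * norm2 g.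
Proof.
move=> Wf Lfv vg; have fW0 : findim_subspace W0 by exact: (zero_mean_findim fW w1 w0).
have nf := norm2_ge0 f; have ng := norm2_ge0 g.
have [->|f0] := eqVneq (norm2 f) 0.
  by rewrite mulr0 mulr_ge0// addr_ge0.
have fp : 0 < norm2 f by rewrite lt_neqAle eq_sym f0.
pose a := (norm2 f)^-1; have a0 : 0 <= a by rewrite invr_ge0.
have Waf : W0 (a *: f) by exact: findimZ.
have [va Lva] := domL Waf.1.
rewrite -ler_pdivlMr// -mulrA [_ / _]mulrC -/a -{1}(ger0_norm a0) -norm2Z.
apply: (compression_lower_bound_unit Waf _ Lva).
  by rewrite norm2Z (ger0_norm a0) mulVf.
split=> [|h Wh]; first by apply: findimZ => //; exact: vg.1.
have [hs Lh] := domLs Wh.1.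
rewrite dotpBl (Lh _ _ Lva) !dotpZl (oproj_dotp vg Wh) (Lh _ _ Lfv).
by rewrite subrr.
Qed.

Let G : oper mu := op_comp (oproj W0) (op_comp Lop (oproj W0)).

(** The inner projection returns an f of [W0] only up to almost-everywhere equality, hence the
    representative [f']. *)
Lemma compressionP f g : W0 f -> G f g <->
  exists f' v, [/\ f = f' %[ae mu], W0 f', Lop f' v & oproj W0 v g].
Proof.
have fW0 : findim_subspace W0 by exact: (zero_mean_findim fW w1 w0).
move=> Wf; split=> [[v [f' pf' Lv] vg]|[f' [v [ff' Wf' Lv vg]]]].
  exists f', v; split=> //; last by case: pf'.
  by apply: (oproj_unique fW0) pf'; exact: oproj_id.
exists v => //; exists f' => //.
by apply: (oproj_ae fW0 _ ff'); exact: oproj_id.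
Qed.

Context (gap : 0 < lam - eps * (delta + delta)).
Let lhat := (lam - eps * (delta + delta)) / (1 + eps).

Lemma compression_norm f g : W0 f -> G f g -> norm2 f <= 1 / lhat * norm2 g.
Proof.
move=> Wf /compressionP-/(_ Wf)[f' [v [ff' Wf' Lv vg]]].
have e1 : 0 < 1 + eps by rewrite ltr_wpDr.
have := compression_lower_bound Wf' Lv vg; rewrite -(ae_norm2 ff').
by rewrite div1r /lhat invf_div mulrAC ler_pdivlMr// [_ * norm2 f]mulrC.
Qed.

(** Coercivity yields injectivity and the norm bound; surjectivity is then a rank count, through
    [pairing_surjective]. *)
Lemma compression_invertible :
  invertible_on W0 G /\ (op_norm (op_inv (op_restr W0 G)) <= (1 / lhat)%:E)%E.
Proof.
have fW0 : findim_subspace W0 by exact: (zero_mean_findim fW w1 w0).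
have lp : 0 < lhat by rewrite divr_gt0// ltr_wpDr.
have dotG f g f' v h : W0 f -> W0 h -> G f g -> f = f' %[ae mu] -> Lop f' v ->
    dotp g h = dotp v h.
  move=> Wf Wh /compressionP-/(_ Wf)[f2 [v2 [ff2 Wf2 Lv2 vg2]]] ff' Lv.
  rewrite (oproj_dotp vg2 Wh); apply: (dotp_image_unique Wh.1 _ Lv2 Lv).
  by apply: L2_ae_trans ff'; exact: L2_ae_sym.
have totG f : W0 f -> exists2 g, W0 g & G f g.
  move=> Wf; have [v Lv] := domL Wf.1; have [g vg] := oproj_exists v fW0.
  exists g; first by case: vg.
  by apply/compressionP => //; exists f, v; split=> //; exact: L2_ae_refl.
split; last first.
  apply: ge_ereal_sup => _ [g [f [[Wf Wg Gfg] ng ->]]]; rewrite lee_fin.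
  rewrite (le_trans (compression_norm Wf Gfg))// ler_piMr// divr_ge0// ltW//.
split=> //.
- move=> f g g' Wf Gg Gg'.
  have [v Lv] := domL Wf.1.
  have [Wg Wg'] : W0 g /\ W0 g'.
    move: Gg Gg' => /compressionP-/(_ Wf)[? [? [_ _ _ [+ _]]]].
    by move=> ? /compressionP-/(_ Wf)[? [? [_ _ _ [+ _]]]].
  apply/ae_eq_norm2; rewrite /norm2 dotpBl.
  have Wgg := findimB fW0 Wg Wg'.
  rewrite (dotG _ _ _ _ _ Wf Wgg Gg (L2_ae_refl f) Lv).
  by rewrite (dotG _ _ _ _ _ Wf Wgg Gg' (L2_ae_refl f) Lv) subrr sqrtr0.
- have [n [e We]] := fW0; have [We1 We2] := findim_lin_comb We.
  have We3 i : W0 (e i).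
    have := We1 (delta_mx 0 i); congr W0.
    rewrite /lin_comb (bigD1 i)//= mxE !eqxx scale1r big1 ?addr0// => j ji.
    by rewrite mxE (negPf ji) scale0r.
  (* One image per generator is fixed. Combinations of these images are a linear substitute for
     [Lop] on the span, and [dotL] shows that they have the right pairings. *)
  have [v Lv] := choice (fun i => domL (We3 i).1).
  have dotL c f' v' h : W0 h -> lin_comb e c = f' %[ae mu] -> Lop f' v' ->
      dotp v' h = dotp (lin_comb v c) h.
    move=> Wh cf' Lf'; have [hs Lh] := domLs Wh.1.
    rewrite (Lh _ _ Lf') -(ae_dotpl _ cf') !dotp_lin_comb.
    by apply: eq_bigr => i _; rewrite -(Lh _ _ (Lv i)).
  have inj c : (forall j, dotp (lin_comb v c) (e j) = 0) -> norm2 (lin_comb e c) = 0.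
    move=> c0; have [g Wg Gg] := totG _ (We1 c).
    apply/eqP; rewrite eq_le norm2_ge0 andbT.
    rewrite (le_trans (compression_norm (We1 c) Gg))//.
    suff -> : norm2 g = 0 by rewrite mulr0.
    have [a ga] := We2 _ Wg; have [v' Lv'] := domL (We1 c).1.
    rewrite /norm2 (ae_dotpr _ ga) dotpC dotp_lin_comb big1 ?sqrtr0// => i _.
    rewrite dotpC (dotG _ _ _ _ _ (We1 c) (We3 i) Gg (L2_ae_refl _) Lv').
    by rewrite (dotL _ _ _ _ (We3 i) (L2_ae_refl _) Lv') c0 mulr0.
  move=> g Wg; have [c gc] := pairing_surjective inj g.
  exists (lin_comb e c) => //.
  have [v' Lv'] := domL (We1 c).1.
  apply/compressionP => //; exists (lin_comb e c), v'; split=> //; first exact: L2_ae_refl.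
  split=> // h Wh; have [a ha] := We2 _ Wh.
  rewrite (ae_dotpr _ ha) dotpC dotp_lin_comb big1// => i _.
  rewrite dotpC dotpBl (dotL _ _ _ _ (We3 i) (L2_ae_refl _) Lv') gc.
  by rewrite subrr mulr0.
- move=> f f' g Wf Wf' /compressionP-/(_ Wf)[f1 [v1 [ff1 Wf1 L1 p1]]].
  move=> /compressionP-/(_ Wf')[f2 [v2 [ff2 Wf2 L2 p2]]].
  have Wff := findimB fW0 Wf Wf'; have [v Lv] := domL Wff.1.
  have G0 : G (f - f') 0.
    apply/compressionP => //; exists (f - f'), v; split=> //; first exact: L2_ae_refl.
    split=> [|h Wh]; first by rewrite -(subrr f); exact: findimB.
    have [hs Lh] := domLs Wh.1.
    rewrite subr0 (Lh _ _ Lv) dotpBl (ae_dotpl _ ff1) (ae_dotpl _ ff2).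
    rewrite -(Lh _ _ L1) -(Lh _ _ L2) -(oproj_dotp p1 Wh) -(oproj_dotp p2 Wh).
    by rewrite subrr.
  apply/ae_eq_norm2/eqP; rewrite eq_le norm2_ge0 andbT.
  by rewrite (le_trans (compression_norm Wff G0))// norm2_0 mulr0.
Qed.

End compression.
End symmetrization.
End bounded_operators.

(** * Smooth cut-offs *)

Section flat_function.
Context (R : realType).
Implicit Types (P : {poly R}) (s y : R).

(* The derivatives of exp(- 1 / s), extended by 0 to s <= 0, are all of this form. *)
Definition flat P s : R := if 0 < s then P.[s^-1] * expR (- s^-1) else 0.

(** The exponential series gives y^n <= n! e^y for y >= 0, applied coefficient by coefficient. *)
Lemma poly_expRN_bounded P :
  exists2 C, 0 <= C & forall y, 0 <= y -> `|P.[y]| * expR (- y) <= C.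
Proof.
have mono n y : 0 <= y -> y ^+ n * expR (- y) <= n`!%:R.
  move=> y0; rewrite expRN ler_pdivrMr ?expR_gt0//.
  case: n => [|n].
    by rewrite expr0 fact0 mul1r (le_trans _ (expR_ge1Dx y))// lerDl.
  rewrite -ler_pdivrMl ?ltr0n ?fact_gt0// mulrC.
  by rewrite (le_trans _ (expR_ge1Dxn n y0))// lerDr.
exists (\sum_(i < size P) `|P`_i| * i`!%:R).
  by apply: sumr_ge0 => i _; rewrite mulr_ge0.
move=> y y0; rewrite horner_coef.
rewrite (le_trans (ler_wpM2r (expR_ge0 _) (ler_norm_sum _ _ _)))//.
rewrite mulr_suml; apply: ler_sum => i _.
by rewrite normrM normrX (ger0_norm y0) -mulrA ler_wpM2l// mono.
Qed.

Lemma flat_le0 P s : s <= 0 -> flat P s = 0.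
Proof. by move=> s0; rewrite /flat ltNge s0. Qed.

Lemma flat_bounded P : exists2 C, 0 <= C & forall s, `|flat P s| <= C.
Proof.
have [C C0 PC] := poly_expRN_bounded P; exists C => // s.
rewrite /flat; case: ifPn => s0; last by rewrite normr0.
by rewrite normrM (ger0_norm (expR_ge0 _)) PC// invr_ge0 ltW.
Qed.

(** With y = 1/s this is boundedness of P(y) y^2 exp(-y). A quadratic bound is enough for a zero
    derivative at 0. *)
Lemma flat_quadratic P : exists2 C, 0 <= C & forall s, `|flat P s| <= C * s ^+ 2.
Proof.
have [C C0 PC] := flat_bounded (P * 'X^2); exists C => // s.
have := PC s; rewrite /flat; case: ifPn => s0; last by rewrite normr0 mulr_ge0// sqr_ge0.
rewrite hornerM hornerXn => le.
rewrite -ler_pdivrMr ?exprn_gt0// (le_trans _ le)//.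
rewrite le_eqVlt; apply/orP; left; apply/eqP.
rewrite mulrAC [in RHS]normrM; congr (_ * _).
by rewrite ger0_norm ?exprVn// invr_ge0 sqr_ge0.
Qed.

(** Chain rule in y = 1/s, whose derivative is - y^2: P(y) exp(-y) becomes y^2 (P(y) - P'(y))
    exp(-y). *)
Definition flat_deriv P : {poly R} := 'X^2 * (P - P^`()).

Lemma is_derive_flat P s : is_derive s 1 (flat P) (flat (flat_deriv P) s).
Proof.
have [s0|s0|->] := ltgtP s 0.
- rewrite (flat_le0 _ (ltW s0)).
  apply: (near_eq_is_derive _ (is_derive_cst (0 : R) s (1 : R))).
  by near=> t; rewrite flat_le0//; near: t; exact: lt_le_nbhsl.
- have -> : flat (flat_deriv P) s = P.[s^-1] * (expR (- s^-1) * - (- s ^- 2)) +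
      expR (- s^-1) * (P^`().[s^-1] * - s ^- 2).
    rewrite /flat s0 /flat_deriv hornerM hornerXn hornerD hornerN exprVn; ring.
  have dV : is_derive s 1 (fun t : R => t^-1) (- s ^- 2).
    have := @is_deriveV R id s 1 1 (lt0r_neq0 s0) (is_derive_id _ _).
    by rewrite /= scaler1.
  have dP : is_derive s 1 (horner P \o (fun t : R => t^-1)) (P^`().[s^-1] * - s ^- 2).
    exact: is_derive1_comp.
  have dE : is_derive s 1 (expR \o (fun t : R => - t^-1)) (expR (- s^-1) * - (- s ^- 2)).
    by apply: is_derive1_comp; exact: is_deriveN.
  apply: (near_eq_is_derive _ (is_deriveM dP dE)).
  by near=> t; rewrite /flat ifT//; near: t; exact: lt_nbhsr.
(* At the gluing point the difference quotient is at most C |h|, by [flat_quadratic]. *)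
- rewrite (flat_le0 _ (lexx _)); have [C C0 PC] := flat_quadratic P.
  suff H : h^-1 *: (flat P (h *: 1 + 0) - flat P 0) @[h --> 0^'] --> 0.
    by apply: DeriveDef; [apply/cvg_ex; exists 0|apply/cvg_lim].
  rewrite (flat_le0 _ (lexx 0)).
  apply/norm_cvg0P; apply: (@squeeze_cvgr _ _ _ _ (cst 0) (fun h => C * `|h|)).
  + near=> h; rewrite normr_ge0 /= addr0 subr0 normrZ normfV [h%:A]mulr1.
    have [->|hn0] := eqVneq h 0; first by rewrite flat_le0// normr0 !mulr0.
    have h0 : 0 < `|h| by rewrite normr_gt0.
    by rewrite ler_pdivrMl// (le_trans (PC h))// -real_normK ?num_real// expr2 mulrCA.
  + exact: cvg_cst.
  + rewrite -[X in _ --> X](mulr0 C); apply: cvgM; first exact: cvg_cst.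
    by apply/cvgr0Pnorm_lt => e e0; near=> h; rewrite normr_id; near: h; exact: dnbhs0_lt.
Unshelve. all: by end_near. Qed.

Lemma continuous_flat P : continuous (flat P).
Proof.
move=> s; apply: differentiable_continuous; apply/derivable1_diffP.
by have [] := is_derive_flat P s.
Qed.

End flat_function.

(** * A class of smooth functions stable under differentiation *)

Section elementary_functions.
Context (R : realType).

(** Restriction to a line makes the one-variable chain rule available for directional
    derivatives. *)
Lemma is_derive_line (U : normedModType R) (f : U -> R) x v df :
  is_derive x v f df <-> is_derive (0 : R) 1 (fun h : R => f (h *: v + x)) df.
Proof.
have dE : 'D_1 (fun h : R => f (h *: v + x)) (0 : R) = 'D_v f x.
  rewrite /derive; set g1 := fun h => h^-1 *: _; set g2 := fun h => h^-1 *: _.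
  suff -> : g1 = g2 by [].
  by rewrite funeqE /g1 /g2 => h /=; rewrite addr0 scale0r add0r [h%:A]mulr1.
split=> -[der val].
  by split; [exact/(derivable1P f x v)|rewrite dE].
by split; [exact/(derivable1P f x v)|rewrite -dE].
Qed.

Lemma is_derive_comp_dir (U : normedModType R) (f : U -> R) (g : R -> R) x v df dg :
  is_derive x v f df -> is_derive (f x) 1 g dg ->
  is_derive x v (fun y => g (f y)) (dg * df).
Proof.
move=> /is_derive_line fd gd; apply/is_derive_line.
apply: (@is_derive1_comp _ g (fun h : R => f (h *: v + x))) => //.
by rewrite scale0r add0r.
Qed.

Context (D : nat).
Local Notation vec := 'rV[R]_D.
Local Notation phase := (vec * vec)%type.

(** [smooth] quantifies over all iterated directional derivatives, so it is proved through a class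
    stable under each of them. Admitting every polynomial P in [elementary_flat] is what makes the
    class stable. *)
Inductive elementary : (phase -> R) -> Prop :=
| elementary_cst c : elementary (fun=> c)
| elementary_fst j : elementary (fun x => x.1 ord0 j)
| elementary_snd j : elementary (fun x => x.2 ord0 j)
| elementary_add f g : elementary f -> elementary g -> elementary (fun x => f x + g x)
| elementary_mul f g : elementary f -> elementary g -> elementary (fun x => f x * g x)
| elementary_flat P f : elementary f -> elementary (fun x => flat P (f x)).

Lemma elementary_sum n (f : 'I_n -> phase -> R) :
  (forall i, elementary (f i)) -> elementary (fun x => \sum_i f i x).
Proof.
elim: n f => [|n IHn] f ef.
  rewrite (_ : (fun x => _) = fun=> 0); first exact: elementary_cst.
  by apply/funext => x; rewrite big_ord0.
rewrite (_ : (fun x => _) = fun x => f ord0 x + \sum_(i < n) f (lift ord0 i) x).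
  by apply: elementary_add => //; apply: IHn => i.
by apply/funext => x; rewrite big_ord_recl.
Qed.

Lemma is_derive_linear (f : phase -> R) x v :
  (forall h y z, f (h *: y + z) = h * f y + f z) -> is_derive x v f (f v).
Proof.
move=> lf; apply/is_derive_line.
have -> : (fun h : R => f (h *: v + x)) = (fun h : R => f v *: h + cst (f x) h).
  by apply/funext => h; rewrite lf mulrC.
rewrite -[X in is_derive _ _ _ X]addr0; apply: is_deriveD.
rewrite -[X in is_derive _ _ _ X]mulr1.
exact: is_deriveZ.
Qed.

Lemma is_derive_fst x v j : is_derive x v (fun x : phase => x.1 ord0 j) (v.1 ord0 j).
Proof. by apply: (is_derive_linear (f := fun x : phase => x.1 ord0 j)) => h y z; rewrite !mxE. Qed.

Lemma is_derive_snd x v j : is_derive x v (fun x : phase => x.2 ord0 j) (v.2 ord0 j).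
Proof. by apply: (is_derive_linear (f := fun x : phase => x.2 ord0 j)) => h y z; rewrite !mxE. Qed.

Lemma is_derive_mul (f g : phase -> R) x v df dg : is_derive x v f df -> is_derive x v g dg ->
  is_derive x v (fun x => f x * g x) (f x * dg + g x * df).
Proof. by move=> fd gd; have := is_deriveM fd gd. Qed.

Lemma elementary_derivable f v : elementary f ->
  exists2 g, elementary g & forall x, is_derive x v f (g x).
Proof.
elim=> [c|j|j|g h _ [g' eg g'P] _ [h' eh h'P]|g h eg0 [g' eg g'P] eh0 [h' eh h'P]
  |P g eg0 [g' eg g'P]].
- by exists (fun=> 0) => [|x]; [exact: elementary_cst|exact: is_derive_cst].
- by exists (fun=> v.1 ord0 j) => [|x]; [exact: elementary_cst|exact: is_derive_fst].
- by exists (fun=> v.2 ord0 j) => [|x]; [exact: elementary_cst|exact: is_derive_snd].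
- by exists (fun x => g' x + h' x) => [|x]; [exact: elementary_add|exact: is_deriveD].
- exists (fun x => g x * h' x + h x * g' x) => [|x]; last exact: is_derive_mul.
  by apply: elementary_add; exact: elementary_mul.
- exists (fun x => flat (flat_deriv P) (g x) * g' x) => [|x].
    by apply: elementary_mul => //; exact: elementary_flat.
  by apply: is_derive_comp_dir => //; exact: is_derive_flat.
Qed.

Lemma elementary_continuous f : elementary f -> continuous f.
Proof.
elim=> [c|j|j|g h _ cg _ ch|g h _ cg _ ch|P g _ cg] x.
- exact: cvg_cst.
- apply: (@continuous_comp _ _ _ fst (fun q : vec => q ord0 j)); first exact: cvg_fst.
  exact: coord_continuous.
- apply: (@continuous_comp _ _ _ snd (fun q : vec => q ord0 j)); first exact: cvg_snd.
  exact: coord_continuous.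
- by apply: cvgD; [exact: cg|exact: ch].
- by apply: cvgM; [exact: cg|exact: ch].
- by apply: (@continuous_comp _ _ _ g (flat P)); [exact: cg|exact: continuous_flat].
Qed.

Lemma elementary_smooth f : elementary f -> smooth f.
Proof.
move=> ef s; have eD g v : elementary g -> elementary ('D_v g).
  move=> /(elementary_derivable v)[g' eg' g'P].
  by rewrite (_ : 'D_v g = g')//; apply/funext => x; have [] := g'P x.
have : elementary (foldr (fun v h => 'D_v h) f s) by elim: s => //= v s; exact: eD.
move: (foldr _ _ _) => g eg; split; first exact: elementary_continuous.
by move=> x v; have [g' _ g'P] := elementary_derivable v eg; have [] := g'P x.
Qed.

Lemma elementary_measurable f : elementary f -> measurable_fun setT f.
Proof.
elim=> [c|j|j|g h _ mg _ mh|g h _ mg _ mh|P g _ mg].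
- exact: measurable_cst.
- by apply: (measurableT_comp (measurable_rV_coord j)); exact: measurable_fst.
- by apply: (measurableT_comp (measurable_rV_coord j)); exact: measurable_snd.
- exact: measurable_funD.
- exact: measurable_funM.
- apply: (measurableT_comp _ mg).
  by apply: continuous_measurable_fun; exact: continuous_flat.
Qed.

End elementary_functions.

Section bounded_L2.
Context d (T : measurableType d) (R : realType) (mu : probability T R).

Lemma bounded_Lfun2 (f : T -> R) (C : R) : measurable_fun setT f ->
  (forall x, `|f x| <= C) -> f \in Lfun mu 2%:E.
Proof.
move=> mf fC; rewrite inE; apply/andP; split; rewrite inE//=.
rewrite /finite_norm unlock poweR_lty//.
apply: (@le_lt_trans _ _ (\int[mu]_x (cst (C `^ 2)%:E) x)%E).
  apply: ge0_le_integral => //.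
  - by move=> x _; rewrite poweR_ge0.
  - apply: (measurableT_comp (measurable_poweR _)).
    by apply: measurableT_comp => //; apply/measurable_EFinP.
  - move=> x _ /=; rewrite lee_fin ge0_ler_powR// nnegrE//.
    exact: le_trans (fC x).
rewrite integral_cst//= (_ : mu setT = 1%E) ?mule1 ?ltry//; exact: probability_setT.
Qed.

(** Dominated convergence, constants being integrable for a probability measure. *)
Lemma bounded_cvg_norm2 (f : nat -> L2 mu) (C : R) : (forall n x, `|f n x| <= C) ->
  (forall x, f n x @[n --> \oo] --> 0) -> norm2 (f n) @[n --> \oo] --> 0.
Proof.
move=> fC f0.
have C0 n x : f n x * f n x <= C ^+ 2.
  by rewrite -expr2 -real_normK ?num_real// ler_pXn2r ?nnegrE ?(le_trans _ (fC n x)).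
have mf n : measurable_fun setT (fun x => f n x).
  by have := LfunP (f n); rewrite inE/= => /andP[/[!inE]].
have ff : {ae mu, forall x, setT x -> (f n x * f n x)%:E @[n --> \oo] --> (cst 0%E) x}.
  apply: aeW => x _; apply: cvg_EFin; first by near=> n.
  by rewrite -[X in _ --> X](mulr0 0); apply: cvgM; exact: f0.
have iC : mu.-integrable setT (cst (C ^+ 2)%:E).
  apply/integrableP; split; first exact: measurable_cst.
  by rewrite integral_cst//= (_ : mu setT = 1%E) ?mule1 ?ltry//; exact: probability_setT.
have fg : {ae mu, forall x n, setT x -> (`|(f n x * f n x)%:E| <= (cst (C ^+ 2)%:E) x)%E}.
  by apply: aeW => x n _; rewrite lee_fin ger0_norm// -expr2 sqr_ge0.
have mff n : measurable_fun setT (fun x => (f n x * f n x)%:E).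
  by apply/measurable_EFinP; exact: measurable_funM.
have [_ _ dc] := dominated_convergence measurableT mff (measurable_cst _) ff iC fg.
suff dotp0 : dotp (f n) (f n) @[n --> \oo] --> 0.
  rewrite -(@sqrtr0 R); apply: (@continuous_cvg _ _ _ _ _ _ (@Num.sqrt R)) => //.
  exact: sqrt_continuous.
rewrite /dotp /Rintegral -[X in _ --> X]/(fine 0%E).
by apply: fine_cvg; rewrite -[X in _ --> X](@integral0 _ _ _ mu setT).
Unshelve. all: by end_near. Qed.

End bounded_L2.

(** * Cut-offs of the constant function and their images under L_FD *)

Section cutoff.
Context (R : realType) (D : nat) (X : position_space R) (beta m : R).
Local Notation vec := 'rV[R]_D.
Local Notation phase := (vec * vec)%type.
Implicit Types (k : R) (x : phase).

(* On the torus the cut-off must be periodic in q: there it acts on p only. *)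
Definition radius2 x : R :=
  (\sum_i x.2 ord0 i * x.2 ord0 i) +
  (if X is Torus _ then 0 else 1) * (\sum_i x.1 ord0 i * x.1 ord0 i).

Definition level k x : R := 1 + (- k) * radius2 x.

(** The bump e exp(-1 / (1 - k r^2)), extended by 0, with r^2 = [radius2]. The factor e makes it
    equal to 1 where r = 0, so it tends to 1 pointwise as k tends to 0. *)
Definition cutoff k x : R := flat (expR 1)%:P (level k x).

Lemma elementary_level k : elementary (level k).
Proof.
apply: elementary_add; first exact: elementary_cst.
apply: elementary_mul; first exact: elementary_cst.
apply: elementary_add.
  by apply: elementary_sum => i; apply: elementary_mul; exact: elementary_snd.
apply: elementary_mul; first exact: elementary_cst.
by apply: elementary_sum => i; apply: elementary_mul; exact: elementary_fst.
Qed.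

Lemma elementary_cutoff k : elementary (cutoff k).
Proof. by apply: elementary_flat; exact: elementary_level. Qed.

Lemma radius2_ge i x : x.2 ord0 i ^+ 2 <= radius2 x.
Proof.
rewrite /radius2 (bigD1 i)//= -expr2 -addrA lerDl addr_ge0//.
  by apply: sumr_ge0 => j _; rewrite -expr2 sqr_ge0.
rewrite mulr_ge0//; first by case: X.
by apply: sumr_ge0 => j _; rewrite -expr2 sqr_ge0.
Qed.

Lemma radius2_ge_pos i x : X = Euclidean -> x.1 ord0 i ^+ 2 <= radius2 x.
Proof.
rewrite /radius2 => ->; rewrite mul1r addrC (bigD1 i)//= -expr2 -addrA lerDl addr_ge0//.
  by apply: sumr_ge0 => j _; rewrite -expr2 sqr_ge0.
by apply: sumr_ge0 => j _; rewrite -expr2 sqr_ge0.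
Qed.

Lemma level_gt0 k x : 0 < k -> 0 < level k x -> radius2 x < k^-1.
Proof.
move=> k0; rewrite /level mulNr subr_gt0 => kr.
by rewrite -(ltr_pM2l k0) mulfV ?gt_eqF.
Qed.

Lemma sqr_le_norm (a b : R) : 0 <= b -> a ^+ 2 <= b ^+ 2 -> `|a| <= b.
Proof. by move=> b0; rewrite -[a ^+ 2]real_normK ?num_real// ler_pXn2r. Qed.

Lemma test_phase_cutoff k : 0 < k -> test_phase X (cutoff k).
Proof.
move=> k0; split; first exact/elementary_smooth/elementary_cutoff.
- rewrite /is_periodic /cutoff /level /radius2; case: X => // a q i.
  by apply/funext => p; rewrite !mul0r.
(* On the support each coordinate entering [radius2] satisfies a^2 < 1/k <= (1/k + 1)^2; this radius
   avoids a square root. *)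
- exists (k^-1 + 1) => q p phi0.
  have l0 : 0 < level k (q, p).
    by rewrite ltNge; apply: contra phi0 => l0; rewrite /cutoff flat_le0.
  have kV : 0 < k^-1 by rewrite invr_gt0.
  have le (a : R) : a ^+ 2 <= radius2 (q, p) -> `|a| <= k^-1 + 1.
    have := level_gt0 k0 l0 => r1 r2; apply: sqr_le_norm; first by rewrite addr_ge0// ltW.
    by nra.
  have norm_le (v : vec) : (forall i, `|v ord0 i| <= k^-1 + 1) -> `|v| <= k^-1 + 1.
    move=> vle; rewrite /Num.Def.normr/= mx_normrE; apply: bigmax_le => [|[a b] _] /=.
      by rewrite addr_ge0// ltW.
    by rewrite ord1.
  split; last by apply: norm_le => i; apply: le; exact: (radius2_ge i (q, p)).
  case XE : X => [//|]; rewrite /pos_bounded; apply: norm_le => i; apply: le.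
  exact: (radius2_ge_pos i (q, p)).
Qed.

Lemma is_derive_sum_fun n (f : 'I_n -> phase -> R) (df : 'I_n -> R) x v :
  (forall i, is_derive x v (f i) (df i)) ->
  is_derive x v (fun x => \sum_i f i x) (\sum_i df i).
Proof.
move=> fd; have := is_derive_sum fd.
by rewrite (_ : \sum_i f i = fun x => \sum_i f i x)//; apply/funext => y; rewrite fct_sumE.
Qed.

Lemma is_derive_level k i x :
  is_derive x (0, ebase R i) (level k) (- k * (2 * x.2 ord0 i)).
Proof.
have d2 j := is_derive_mul (is_derive_snd x (0, ebase R i) j) (is_derive_snd x (0, ebase R i) j).
have d1 j := is_derive_mul (is_derive_fst x (0, ebase R i) j) (is_derive_fst x (0, ebase R i) j).
have dr := is_deriveD (is_derive_sum_fun d2)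
  (is_derive_mul (is_derive_cst (if X is Torus _ then 0 else 1 : R) x (0, ebase R i))
     (is_derive_sum_fun d1)).
have := is_deriveD (is_derive_cst (1 : R) x (0, ebase R i))
  (is_derive_mul (is_derive_cst (- k) x (0, ebase R i)) dr).
move=> dl; apply: is_derive_eq dl _.
rewrite /= (bigD1 i)//= big1 => [|j ji]; last first.
  by rewrite !mxE /= (negPf ji) mulr0 addr0.
have -> : \sum_j (x.1 ord0 j * (0 : vec) ord0 j + x.1 ord0 j * (0 : vec) ord0 j) = 0.
  by apply: big1 => j _; rewrite mxE mulr0 addr0.
by rewrite !mxE !eqxx /=; ring.
Qed.

Let flat1 := flat (flat_deriv (expR 1)%:P : {poly R}).
Let flat2 := flat (flat_deriv (flat_deriv (expR 1)%:P) : {poly R}).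

Lemma dp_cutoff k i : dp i (cutoff k) =
  fun x => flat1 (level k x) * (- k * (2 * x.2 ord0 i)).
Proof.
apply/funext => x; rewrite /dp.
by have [] := is_derive_comp_dir (is_derive_level k i x) (is_derive_flat (expR 1)%:P _).
Qed.

Lemma dp_dp_cutoff k i : dp i (dp i (cutoff k)) = fun x =>
  flat1 (level k x) * (- k * 2) + (- k * (2 * x.2 ord0 i)) *
    (flat2 (level k x) * (- k * (2 * x.2 ord0 i))).
Proof.
rewrite dp_cutoff; apply/funext => x; rewrite /dp.
have dfl := is_derive_comp_dir (is_derive_level k i x) (is_derive_flat (flat_deriv (expR 1)%:P) _).
have dlin := is_derive_mul (is_derive_cst (- k) x (0, ebase R i))
  (is_derive_mul (is_derive_cst (2 : R) x (0, ebase R i)) (is_derive_snd x (0, ebase R i) i)).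
have [_ ->] := is_derive_mul dfl dlin.
by rewrite /= !mxE !eqxx /flat1 /flat2 /=; ring.
Qed.

Definition fd_cutoff k x : R := \sum_i (- (x.2 ord0 i / m) *
    (flat1 (level k x) * (- k * (2 * x.2 ord0 i))) +
  beta^-1 * (flat1 (level k x) * (- k * 2) + (- k * (2 * x.2 ord0 i)) *
    (flat2 (level k x) * (- k * (2 * x.2 ord0 i))))).

Lemma fd_expr_cutoff k : fd_expr beta m (cutoff k) = fd_cutoff k.
Proof.
by apply/funext => x; apply: eq_bigr => i _; rewrite dp_dp_cutoff dp_cutoff.
Qed.

Lemma elementary_fd_cutoff k : elementary (fd_cutoff k).
Proof.
have el := elementary_level k.
have ef P : elementary (fun x => flat P (level k x)) by exact: elementary_flat.
have ep (c : R) i : elementary (fun x : phase => c * (2 * x.2 ord0 i)).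
  apply: elementary_mul; first exact: elementary_cst.
  apply: elementary_mul; first exact: elementary_cst.
  exact: elementary_snd.
apply: elementary_sum => i; apply: elementary_add.
  apply: elementary_mul; last by apply: elementary_mul; [exact: ef|exact: ep].
  rewrite (_ : (fun x => _) = fun x : phase => (- m^-1) * x.2 ord0 i).
    by apply: elementary_mul; [exact: elementary_cst|exact: elementary_snd].
  by apply/funext => x; rewrite mulNr mulrC.
apply: elementary_mul; first exact: elementary_cst.
apply: elementary_add.
  by apply: elementary_mul; [exact: ef|exact: elementary_cst].
apply: elementary_mul; first exact: ep.
by apply: elementary_mul; [exact: ef|exact: ep].
Qed.

(** The drift is of order k p_i^2 and the second derivatives of order k + k^2 p_i^2. On the support
    k p_i^2 <= 1, so the indicator makes the bound uniform in x, while at fixed x it still tends to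
    0 with k. *)
Lemma fd_cutoff_le : exists2 K, 0 <= K & forall k x, 0 < k <= 1 ->
  `|fd_cutoff k x| <= \sum_i K * (k + (if 0 < level k x then k * x.2 ord0 i ^+ 2 else 0)).
Proof.
have [C1 C10 f1] := flat_bounded (flat_deriv (expR 1)%:P : {poly R}).
have [C2 C20 f2] := flat_bounded (flat_deriv (flat_deriv (expR 1)%:P) : {poly R}).
pose K1 := `|m^-1| * (2 * C1); pose K2 := `|beta^-1| * (2 * C1 + 4 * C2).
have K10 : 0 <= K1 by rewrite !mulr_ge0.
have K20 : 0 <= K2 by rewrite mulr_ge0// addr_ge0// mulr_ge0.
exists (K1 + K2); first exact: addr_ge0.
move=> k x /andP[k0 k1]; rewrite (le_trans (ler_norm_sum _ _ _))//.
apply: ler_sum => i _; case: ifPn => [l0|].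
  set p := x.2 ord0 i; set a1 := flat1 _; set a2 := flat2 _.
  have a1C : `|a1| <= C1 by exact: f1.
  have a2C : `|a2| <= C2 by exact: f2.
  have p1 : k * p ^+ 2 <= 1.
    rewrite -(mulfV (lt0r_neq0 k0)) ler_pM2l// (le_trans (radius2_ge i x))//.
    exact/ltW/level_gt0.
  have kp0 : 0 <= k * p ^+ 2 by rewrite mulr_ge0 ?sqr_ge0// ltW.
  have -> : - (p / m) * (a1 * (- k * (2 * p))) +
      beta^-1 * (a1 * (- k * 2) + - k * (2 * p) * (a2 * (- k * (2 * p)))) =
      m^-1 * (2 * a1) * (k * p ^+ 2) +
      beta^-1 * ((- (2 * a1)) * k + k * ((4 * a2) * (k * p ^+ 2))).
    by rewrite expr2; ring.
  rewrite (le_trans (ler_normD _ _))//.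
  rewrite [in leRHS]mulrDl lerD//.
    rewrite normrM (ger0_norm kp0) normrM [`|2 * a1|]normrM (ger0_norm (ler0n _ 2)) /K1.
    rewrite ler_pM// ?mulr_ge0//; last by rewrite lerDr ltW.
    by rewrite ler_wpM2l// ler_wpM2l.
  rewrite normrM /K2 -[leRHS]mulrA ler_wpM2l// (le_trans (ler_normD _ _))//.
  have -> : `|- (2 * a1) * k| = 2 * `|a1| * k.
    by rewrite normrM normrN normrM (ger0_norm (ltW k0)) ger0_norm.
  have -> : `|k * (4 * a2 * (k * p ^+ 2))| = k * (4 * `|a2| * (k * p ^+ 2)).
    rewrite normrM (ger0_norm (ltW k0)) normrM (ger0_norm kp0) [`|4 * a2|]normrM.
    by rewrite (ger0_norm (ler0n _ 4)).
  rewrite [leRHS]mulrDl lerD//.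
    by rewrite ler_pM// ?mulr_ge0// ?(ltW k0)// ?ler_wpM2l// lerDl.
  have kt : k * (k * p ^+ 2) <= k + k * p ^+ 2 by nra.
  have a24 : 4 * `|a2| <= 4 * C2 by rewrite ler_wpM2l.
  by rewrite mulrCA ler_pM// mulr_ge0// ltW.
rewrite -leNgt => l0; rewrite /flat1 /flat2 !flat_le0// !mul0r !mulr0 addr0 mulr0 addr0 normr0.
by rewrite addr0 mulr_ge0// ?addr_ge0// ltW.
Qed.

Context (mu : probability phase R).

(** The constant need not be a test function, so it is reached in the closure along cut-offs with k
    = 1/(n+1). The cut-offs and their images are uniformly bounded and converge pointwise, hence in
    norm. *)
Lemma LFD_one : LFD X beta m (one2 mu) 0.
Proof.
pose k n : R := n.+1%:R^-1.
have k01 n : 0 < k n <= 1 by rewrite /k invr_gt0 ltr0n/= invf_le1 ?ltr0n// ler1n.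
have kn0 : k n @[n --> \oo] --> 0 by exact: cvg_harmonic.
have [K K0 fdK] := fd_cutoff_le.
have [C C0 fC] := flat_bounded ((expR 1)%:P : {poly R}).
have fdC n x : `|fd_cutoff (k n) x| <= \sum_(i < D) K * 2.
  rewrite (le_trans (fdK _ x (k01 n)))//; apply: ler_sum => i _.
  have /andP[kp k1] := k01 n.
  rewrite ler_wpM2l// (_ : 2 = 1 + 1)// lerD//; case: ifPn => // l0.
  rewrite -(mulfV (lt0r_neq0 kp)) ler_pM2l// (le_trans (radius2_ge i x))//.
  exact/ltW/level_gt0.
have Lphi n : cutoff (k n) \in Lfun mu 2%:E.
  apply: (@bounded_Lfun2 _ _ _ mu _ C); last by move=> x; exact: fC.
  by apply: elementary_measurable; exact: elementary_cutoff.
have Lfd n : fd_cutoff (k n) \in Lfun mu 2%:E.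
  apply: bounded_Lfun2 (fdC n).
  by apply: elementary_measurable; exact: elementary_fd_cutoff.
exists (fun n => Lfun_Sub (lee1n 2) (Lphi n) : L2 mu).
exists (fun n => Lfun_Sub (lee1n 2) (Lfd n) : L2 mu); split.
- move=> n; split=> [|x]; first by apply: test_phase_cutoff; case/andP: (k01 n).
  by rewrite /= fd_expr_cutoff.
- apply: (@bounded_cvg_norm2 _ _ _ mu _ (C + 1)) => [n x|x].
    change (`|cutoff (k n) x - 1| <= C + 1).
    by rewrite (le_trans (ler_normB _ _))// normr1 lerD2r; exact: fC.
  change (cutoff (k n) x - 1 @[n --> \oo] --> 0).
  rewrite -(subrr 1); apply: cvgB; last exact: cvg_cst.
  have <- : flat (expR 1)%:P 1 = 1 :> R.
    by rewrite /flat ltr01 hornerC invr1 -expRD subrr expR0.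
  apply: (@continuous_cvg _ _ _ _ _ _ (flat (expR 1)%:P)).
    exact: continuous_flat.
  rewrite /level -[X in _ --> X]addr0; apply: cvgD; first exact: cvg_cst.
  rewrite -[X in _ --> X](mul0r (radius2 x)); apply: cvgM; last exact: cvg_cst.
  by rewrite -oppr0; exact: cvgN.
- apply: (@bounded_cvg_norm2 _ _ _ mu _ (\sum_(i < D) K * 2)) => [n x|x].
    change (`|fd_cutoff (k n) x - 0| <= \sum_(i < D) K * 2).
    by rewrite subr0.
  change (fd_cutoff (k n) x - 0 @[n --> \oo] --> 0).
  apply: (@squeeze_cvgr _ _ _ _
    (fun n => - (k n * \sum_i K * (1 + x.2 ord0 i ^+ 2)))
    (fun n => k n * \sum_i K * (1 + x.2 ord0 i ^+ 2))).
  + near=> n; rewrite -ler_norml subr0 (le_trans (fdK _ x (k01 n)))//.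
    rewrite mulr_sumr; apply: ler_sum => i _; have /andP[kp k1] := k01 n.
    rewrite [leRHS]mulrCA ler_wpM2l// mulrDr mulr1 lerD2l; case: ifPn => // _.
    by rewrite mulr_ge0 ?sqr_ge0// ltW.
  + rewrite -[X in _ --> X]oppr0; apply: cvgN.
    by rewrite -[X in _ --> X](mul0r (\sum_i K * (1 + x.2 ord0 i ^+ 2)));
      apply: cvgM => //; exact: cvg_cst.
  + by rewrite -[X in _ --> X](mul0r (\sum_i K * (1 + x.2 ord0 i ^+ 2)));
      apply: cvgM => //; exact: cvg_cst.
Unshelve. all: by end_near. Qed.

End cutoff.

(** * Langevin dynamics *)

Section langevin_galerkin.
Context (R : realType) (D : nat) (X : position_space R) (beta m : R)
  (V : 'rV[R]_D -> R) (mu : probability ('rV[R]_D * 'rV[R]_D)%type R)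
  (kappa : probability 'rV[R]_D R) (A As : L2 mu -> L2 mu).
Local Notation E := (L2 mu).
Implicit Types (f g v : E) (gamma eps lam : R) (W : set E).

Lemma is_A_norm f : is_A X m V kappa A -> norm2 (A f) <= 2^-1 * norm2 f.
Proof.
move=> A_def.
apply: op_closure_bound (@regularized_inverse_norm _ _ _ _ _) _ _ ((A_def f (A f)).2 _).
  by rewrite invr_ge0.
exact: L2_ae_refl.
Qed.

Lemma derive_sub_cst (U : normedModType R) (h : U -> R) (c : R) (d : U) :
  'D_d (fun x => h x - c) = 'D_d h.
Proof.
apply/funext => x; rewrite /derive.
set g1 := fun h => h^-1 *: _; set g2 := fun h => h^-1 *: _.
suff -> : g1 = g2 by [].
by rewrite funeqE /g1 /g2 => t /=; rewrite opprB addrA subrK.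
Qed.

(** Differentiation kills the mean. [hypocoercive] takes the image of the centred function, the
    graph of [L] that of the test function itself. *)
Lemma langevin_expr_Pi0 gamma f :
  langevin_expr beta m V gamma (Pi0 f) = langevin_expr beta m V gamma f.
Proof.
have P0 : (Pi0 f : _ -> R) = fun x => f x - mean f.
  by apply/funext => x; change (f x - mean f * 1 = f x - mean f); rewrite mulr1.
have dqE i : dq i (Pi0 f) = dq i f by rewrite /dq P0 derive_sub_cst.
have dpE i : dp i (Pi0 f) = dp i f by rewrite /dp P0 derive_sub_cst.
have hamE x : ham_expr m V (Pi0 f) x = ham_expr m V f x.
  by apply: eq_bigr => i _; rewrite dqE dpE.
have fdE x : fd_expr beta m (Pi0 f) x = fd_expr beta m f x.
  by apply: eq_bigr => i _; rewrite dpE.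
by apply/funext => x; rewrite /langevin_expr hamE fdE.
Qed.

Context (A_norm : forall f, norm2 (A f) <= 2^-1 * norm2 f) (A_adj : is_adjoint A As).

Lemma L_coercive gamma eps lam : hypocoercive X beta m V A gamma eps lam ->
  forall f v, L X beta m V gamma f v -> lam * norm2 (Pi0 f) ^+ 2 <=
    - dotp v (Pi0 f) + eps * dotp v (sym_op A As (Pi0 f)).
Proof.
move=> hyp; apply: op_closure_coercive => // f g [tf gE].
have gE0 x : g x = langevin_expr beta m V gamma (Pi0 f) x by rewrite langevin_expr_Pi0.
apply: (le_trans (hyp f g tf gE0)).
rewrite dotpNl -addrA -mulrDr le_eqVlt; apply/orP; left; apply/eqP.
by rewrite /sym_op dotpDr -A_adj [dotp g (A _)]dotpC [in RHS](addrC (dotp (A _) g)).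
Qed.

(** One image v with small defects is requested, not all images: the stabilized case yields the
    bounds for the particular image [h + gamma *: k] with k in W. *)
Definition truncated gamma W (delta : R) := forall w f, oproj W (one2 mu) w ->
  W f -> norm2 f <= 1 -> exists v, [/\ L X beta m V gamma f v,
    forall z, oproj W v z -> norm2 (sym_op A As (v - z)) <= delta &
    `|dotp v ((norm2 w)^-1 *: w)| <= delta].

Lemma truncated_inverse_bound gamma eps lam W w delta : 0 <= eps ->
  hypocoercive X beta m V A gamma eps lam ->
  findim_subspace W -> oproj W (one2 mu) w -> ~ w = 0 %[ae mu] ->
  regular X beta m V gamma W -> truncated gamma W delta ->
  0 < lam - eps * (delta + delta) ->
  inverse_bound X beta m V gamma W
    (1 / ((lam - eps * (delta + delta)) / (1 + eps))).
Proof.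
move=> eps0 hyp fW w1 w0 reg tr gap.
apply: (compression_invertible A_norm A_adj eps0 (L_coercive hyp) fW w1 w0 _ _ _ gap).
- move=> f /reg[[h fh] [k fk] /(_ h k fh fk)[Lf _]]; by exists (h + gamma *: k).
- move=> f /reg[[h fh] [k fk] /(_ h k fh fk)[_ Lf]]; by exists (- h + gamma *: k).
- by move=> f [Wf _] f1; exact: tr.
Qed.

Definition truncation_graph gamma W : oper mu :=
  op_comp (op_graph (fun f => A f + As f))
    (op_comp (op_id_sub (oproj W)) (op_comp (L X beta m V gamma) (oproj W))).

(** A sum, so that one number dominates both defects. The absolute value makes nonnegativity
    immediate; [fine] is meaningful only once the norm is finite. *)
Definition truncation_rate gamma W (Lu : E) : R :=
  `|fine (op_norm (truncation_graph gamma W))| + norm2 Lu.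

Lemma truncation_rate_ge0 gamma W Lu : 0 <= truncation_rate gamma W Lu.
Proof. by rewrite addr_ge0 ?norm2_ge0. Qed.

Lemma truncation_rateP gamma W w u Lu f v : findim_subspace W ->
  op_norm (truncation_graph gamma W) \is a fin_num ->
  normalized_one W u -> Lstar X beta m V gamma u Lu ->
  oproj W (one2 mu) w -> W f -> norm2 f <= 1 -> L X beta m V gamma f v ->
  (forall z, oproj W v z ->
     norm2 (sym_op A As (v - z)) <= truncation_rate gamma W Lu) /\
  `|dotp v ((norm2 w)^-1 *: w)| <= truncation_rate gamma W Lu.
Proof.
move=> fW fin [w' pw' uw'] Lu' pw Wf f1 Lfv; split=> [z vz|].
  rewrite /truncation_rate ler_wpDr ?norm2_ge0// (le_trans _ (ler_norm _))//.
  (* As f already lies in W, [v - z] is a value of (1 - Pi) L Pi at f, and the supremum applies. *)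
  rewrite -lee_fin fineK//; apply: ereal_sup_ubound.
  exists f, (sym_op A As (v - z)); split=> //.
  exists (v - z); last exact: L2_ae_refl.
  exists v; first by exists f => //; exact: oproj_id.
  by exists z => //; exact: L2_ae_refl.
(* The pairing becomes <f, Lu> by the adjoint; [u] and the normalized [w] and [w'] agree only almost
   everywhere. *)
rewrite /truncation_rate ler_wpDl// dotpZr -(ae_norm2 (oproj_unique fW pw' pw)).
rewrite -(ae_dotpr _ (oproj_unique fW pw' pw)) -dotpZr -(ae_dotpr _ uw') (Lu' _ _ Lfv).
by rewrite (le_trans (dotp_norm_le _ _))// ler_piMl ?norm2_ge0.
Qed.

Lemma consistent_rate gamma (W : nat -> set E) : consistent X beta m V A As gamma W ->
  (forall M, (1 <= M)%N -> findim_subspace (W M)) ->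
  exists delta : nat -> R, [/\ forall M, 0 <= delta M,
    delta M @[M --> \oo] --> 0 &
    exists2 M1, (1 <= M1)%N & forall M, (M1 <= M)%N ->
      forall w f v, oproj (W M) (one2 mu) w -> W M f -> norm2 f <= 1 ->
        L X beta m V gamma f v ->
      (forall z, oproj (W M) v z -> norm2 (sym_op A As (v - z)) <= delta M) /\
      `|dotp v ((norm2 w)^-1 *: w)| <= delta M].
Proof.
move=> [norm0 [u [Lu [uLu Lu0]]]] fW.
(* Convergence in the extended reals makes the norms finite only from some rank on, which yields
   [M1]. *)
have /fine_cvgP[fin fine0] := norm0.
exists (fun M => truncation_rate gamma (W M) (Lu M)); split.
- by move=> M; exact: truncation_rate_ge0.
- rewrite /truncation_rate -[X in _ --> X]addr0; apply: cvgD => //.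
  by rewrite -(@normr0 _ R); apply: cvg_norm.
- have [M1 _ M1P] := fin; exists (maxn 1 M1); first exact: leq_maxl.
  move=> M; rewrite geq_max => /andP[M0 MM1] w f v pw Wf f1 Lfv.
  have [nu Lus] := uLu M M0.
  by apply: truncation_rateP nu Lus pw Wf f1 Lfv => //; [exact: fW|exact: M1P].
Qed.

Lemma stabilized_truncated gamma0 gamma W delta : findim_subspace W ->
  (forall gamma', 0 < gamma' -> regular X beta m V gamma' W) ->
  stabilizes X beta m W -> 0 < gamma0 -> 0 < gamma ->
  (forall w f v, oproj W (one2 mu) w -> W f -> norm2 f <= 1 ->
     L X beta m V gamma0 f v ->
     (forall z, oproj W v z -> norm2 (sym_op A As (v - z)) <= delta) /\
     `|dotp v ((norm2 w)^-1 *: w)| <= delta) ->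
  truncated gamma W delta.
Proof.
move=> fW reg stab g0 g1 tr w f pw Wf f1.
have W0 : W 0 by rewrite -(subrr f); exact: findimB.
have [w' pw' FDw'] : op_comp (LFD X beta m (mu := mu)) (oproj W) (one2 mu) 0.
  by apply: stab; exists 0; [exact: LFD_one|exact: oproj_id].
have [[hw Hw] _ _] := reg _ g0 _ pw'.1.
have Lsw gamma' : 0 < gamma' -> Lstar X beta m V gamma' w' (- hw + gamma' *: 0).
  by move=> g'0; have [_ _ /(_ hw 0 Hw FDw')[]] := reg _ g'0 _ pw'.1.
have ww' := oproj_unique fW pw' pw.
have [[h Hh] [k0 FDk0] _] := reg _ g0 _ Wf.
have [k pk] := oproj_exists k0 fW.
(* Stabilization turns the projection [k] of an arbitrary image [k0] into an image of f that lies in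
   W. *)
have [f' pf' FDf'] : op_comp (LFD X beta m (mu := mu)) (oproj W) f k by apply: stab; exists k0.
have FDk : LFD X beta m f k.
  by apply: op_closure_ae FDf' _; apply: oproj_unique pf' _ => //; exact: oproj_id.
have Lf gamma' : 0 < gamma' -> L X beta m V gamma' f (h + gamma' *: k).
  by move=> g'0; have [_ _ /(_ h k Hh FDk)[]] := reg _ g'0 _ Wf.
have [tr1 tr2] := tr w f _ pw Wf f1 (Lf _ g0).
exists (h + gamma *: k); split; first exact: Lf.
(* Replacing gamma by [gamma0] changes the image by a multiple of [k], an element of W; shifting the
   projection by the same multiple leaves the defect unchanged. *)
- move=> z [Wz pz]; pose z0 := z - gamma *: k + gamma0 *: k.
  have zz0 : h + gamma *: k - z = h + gamma0 *: k - z0.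
    by rewrite /z0 opprD addrACA -addrA subrr addr0 opprB addrA.
  rewrite zz0; apply: tr1; split; last by move=> v Wv; rewrite -zz0 pz.
  apply: findimD => //; last exact: findimZ pk.1.
  by apply: findimB => //; exact: findimZ pk.1.
(* The adjoint image of [w'] is [- hw + gamma *: 0], where gamma disappears. *)
- rewrite dotpZr -(ae_dotpr _ ww') (Lsw _ g1 _ _ (Lf _ g1)).
  have := tr2; rewrite dotpZr -(ae_dotpr _ ww') (Lsw _ g0 _ _ (Lf _ g0)).
  by rewrite !scaler0.
Qed.

End langevin_galerkin.

Theorem corollary3 (R : realType) (D : nat) (X : position_space R)
    (beta m : R) (V : 'rV[R]_D -> R)
    (mu : probability ('rV[R]_D * 'rV[R]_D)%type R)
    (nu kappa : probability 'rV[R]_D R)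
    (Cnu c1 c2 c3 : R)
    (A As : L2 mu -> L2 mu)
    (ebar lbar : R) (ltilde : R -> R)
    (D_ge1 : (1 <= D)%N) (X_wf : wf_space X)
    (beta_gt0 : 0 < beta) (m_gt0 : 0 < m)
    (V_smooth : smooth V) (V_periodic : is_periodic X V)
    (V_int : (leb R D).-integrable (cell X)
               (fun q => (expR (- beta * V q))%:E))
    (mu_def : gibbs_measure X beta m V mu)
    (nu_def : gibbs_position X beta V nu)
    (kappa_def : maxwellian beta m kappa)
    (Cnu_gt0 : 0 < Cnu) (nu_poincare : poincare X nu Cnu)
    (c1_gt0 : 0 < c1) (c2_ge0 : 0 <= c2) (c2_lt1 : c2 < 1) (c3_gt0 : 0 < c3)
    (V_bounds : potential_bounds V c1 c2 c3)
    (A_def : is_A X m V kappa A) (As_def : is_adjoint A As)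
    (ebar_gt0 : 0 < ebar) (ebar_lt1 : ebar < 1) (lbar_gt0 : 0 < lbar)
    (ltilde_gt0 : forall gamma, 0 < gamma -> 0 < ltilde gamma) :
  let eps gamma := ebar * Num.min gamma gamma^-1 in
  let lambda gamma := ltilde gamma / (1 + eps gamma) in
  (forall gamma, 0 < gamma ->
     hypocoercive X beta m V A gamma (eps gamma) (ltilde gamma)) ->
  (forall gamma, 0 < gamma -> lbar * Num.min gamma gamma^-1 <= lambda gamma) ->
  exists2 C : R, 1 <= C &
  forall W : nat -> set (L2 mu),
    (forall M, (1 <= M)%N -> findim_subspace (W M)) ->
    (forall M w, (1 <= M)%N ->
       oproj (W M) (one2 mu) w -> ~ w = 0 %[ae mu]) ->
  exists lhat : R -> nat -> R,
    (forall gamma, 0 < gamma ->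
       (forall M, (1 <= M)%N -> regular X beta m V gamma (W M)) ->
       consistent X beta m V A As gamma W ->
       (exists2 M0, (1 <= M0)%N & forall M, (M0 <= M)%N ->
          0 < lhat gamma M /\
          inverse_bound X beta m V gamma (W M) (C / lhat gamma M)) /\
       (lhat gamma M @[M --> \oo] --> lambda gamma))
    /\
    ((forall gamma M, 0 < gamma -> (1 <= M)%N ->
        regular X beta m V gamma (W M)) ->
     (exists2 gamma, 0 < gamma & consistent X beta m V A As gamma W) ->
     (forall M, (1 <= M)%N -> stabilizes X beta m (W M)) ->
     exists2 Mstar, (1 <= Mstar)%N &
     exists2 lbarM : nat -> R, lbarM M @[M --> \oo] --> lbar &
     forall M, (Mstar <= M)%N -> forall gamma, 0 < gamma ->
       [/\ 0 < lhat gamma M,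
           inverse_bound X beta m V gamma (W M) (C / lhat gamma M) &
           lbarM M * Num.min gamma gamma^-1 <= lhat gamma M]).
Proof.
move=> eps lambda hyp lambda_ge; exists 1 => // W fW w0.
have A_norm f : norm2 (A f) <= 2^-1 * norm2 f by exact: is_A_norm A_def.
have min_gt0 (gamma : R) : 0 < gamma -> 0 < Num.min gamma gamma^-1.
  by move=> g0; rewrite lt_min g0 invr_gt0.
have eps_ge0 gamma : 0 < gamma -> 0 <= eps gamma.
  by move=> g0; rewrite mulr_ge0 ?ltW// min_gt0.
have wE M : (1 <= M)%N -> exists2 w, oproj (W M) (one2 mu) w & ~ w = 0 %[ae mu].
  move=> M1; have [w pw] := oproj_exists (one2 mu) (fW M M1).
  by exists w => //; exact: w0 pw.
pose good gamma (delta : nat -> R) := [/\ forall M, 0 <= delta M,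
  delta M @[M --> \oo] --> 0 &
  exists2 M1, (1 <= M1)%N & forall M, (M1 <= M)%N ->
    truncated X beta m V A As gamma (W M) (delta M)].
pose reg gamma := forall M, (1 <= M)%N -> regular X beta m V gamma (W M).
pose stable := [/\ forall gamma M, 0 < gamma -> (1 <= M)%N ->
    regular X beta m V gamma (W M),
  exists2 gamma, 0 < gamma & consistent X beta m V A As gamma W &
  forall M, (1 <= M)%N -> stabilizes X beta m (W M)].
have consistent_good gamma : reg gamma -> consistent X beta m V A As gamma W ->
    exists delta, good gamma delta.
  move=> rg cg; have [delta [d0 dc [M1 M11 tr]]] := consistent_rate cg fW.
  exists delta; split=> //; exists M1 => // M MM1 w f pw Wf f1.
  have [[h Hh] [k Hk] /(_ h k Hh Hk)[Lf _]] := rg M (leq_trans M11 MM1) f Wf.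
  exists (h + gamma *: k); split=> //; first by move=> z; exact: (tr M MM1 w f _ pw Wf f1 Lf).1.
  exact: (tr M MM1 w f _ pw Wf f1 Lf).2.
(* [lhat] is chosen before either set of hypotheses and must serve both. Excluded middle on [stable]
   settles this: if it holds, one sequence is used for all gamma; otherwise each consistent gamma
   gets its own by choice. *)
have [delta [delta_good delta_stable]] : exists delta : R -> nat -> R,
    (forall gamma, 0 < gamma -> reg gamma ->
       consistent X beta m V A As gamma W -> good gamma (delta gamma)) /\
    (stable -> exists dl : nat -> R, [/\ delta = (fun=> dl), forall M, 0 <= dl M,
       dl M @[M --> \oo] --> 0 & exists2 M1, (1 <= M1)%N &
       forall M gamma, (M1 <= M)%N -> 0 < gamma ->
         truncated X beta m V A As gamma (W M) (dl M)]).
  have [st|nst] := pselect stable; last first.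
    have [delta dP] : exists delta : R -> nat -> R, forall gamma, 0 < gamma ->
        reg gamma -> consistent X beta m V A As gamma W -> good gamma (delta gamma).
      suff /choice[delta dP] : forall gamma, exists dl, 0 < gamma -> reg gamma ->
          consistent X beta m V A As gamma W -> good gamma dl by exists delta.
      move=> gamma; have [[rg cg]|n] := pselect (reg gamma /\
        consistent X beta m V A As gamma W).
        by have [dl gdl] := consistent_good gamma rg cg; exists dl.
      (* A default value where regularity or consistency fails, since nothing is claimed there. *)
      by exists (fun=> 0) => _ rg cg; case: n.
    by exists delta; split.
  have [rg [gamma0 g0 cg] stab] := st.
  have [dl [d0 dc [M1 M11 tr]]] := consistent_rate cg fW.
  have trdl M gamma : (M1 <= M)%N -> 0 < gamma ->
      truncated X beta m V A As gamma (W M) (dl M).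
    move=> MM1 gp; have M0 := leq_trans M11 MM1.
    apply: (stabilized_truncated (fW M M0) _ (stab M M0) g0 gp (tr M MM1)).
    by move=> g' g'0; exact: rg.
  exists (fun=> dl); split=> [gamma gp _ _|_]; last by exists dl; split=> //; exists M1.
  by split=> //; exists M1 => // M MM1; exact: trdl.
exists (fun gamma M => (ltilde gamma - eps gamma * (delta gamma M + delta gamma M)) /
  (1 + eps gamma)).
have bound gamma M dl : 0 < gamma -> (1 <= M)%N -> regular X beta m V gamma (W M) ->
    truncated X beta m V A As gamma (W M) dl ->
    0 < ltilde gamma - eps gamma * (dl + dl) ->
    inverse_bound X beta m V gamma (W M)
      (1 / ((ltilde gamma - eps gamma * (dl + dl)) / (1 + eps gamma))).
  move=> gp M1 rg tr gap; have [w pw wn0] := wE M M1.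
  exact: (truncated_inverse_bound A_norm As_def (eps_ge0 _ gp) (hyp _ gp) (fW M M1) pw).
have eps1 gamma : 0 < gamma -> 0 < 1 + eps gamma.
  by move=> gp; rewrite ltr_wpDr// eps_ge0.
split.
  move=> gamma gp rg cg; have [d0 dc [M1 M11 tr]] := delta_good gamma gp rg cg.
  have gapc : ltilde gamma - eps gamma * (delta gamma M + delta gamma M)
      @[M --> \oo] --> ltilde gamma.
    rewrite -[X in _ --> X]subr0; apply: cvgB; first exact: cvg_cst.
    rewrite -[X in _ --> X](mulr0 (eps gamma)); apply: cvgM; first exact: cvg_cst.
    by rewrite -[X in _ --> X]addr0; exact: cvgD.
  split; last by apply: cvgM => //; exact: cvg_cst.
  have [M2 _ gap] := cvgr_gt _ gapc _ (ltilde_gt0 _ gp).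
  exists (maxn M1 M2); first by rewrite leq_max M11.
  move=> M; rewrite geq_max => /andP[MM1 MM2]; have M0 := leq_trans M11 MM1.
  have gapM := gap M MM2.
  split; first by rewrite divr_gt0// eps1.
  by apply: bound => //; [exact: rg|exact: tr].
move=> rg cons stab; have [//|dl [-> d0 dc [M1 M11 tr]]] := delta_stable _.
have lc : lbar - ebar * (dl M + dl M) @[M --> \oo] --> lbar.
  rewrite -[X in _ --> X]subr0; apply: cvgB; first exact: cvg_cst.
  rewrite -[X in _ --> X](mulr0 ebar); apply: cvgM; first exact: cvg_cst.
  by rewrite -[X in _ --> X]addr0; exact: cvgD.
(* This threshold involves only [lbar], [ebar] and [dl], so [Mstar] does not depend on gamma. *)
have [M2 _ gap] := cvgr_gt _ lc _ lbar_gt0.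
exists (maxn M1 M2); first by rewrite leq_max M11.
exists (fun M => lbar - ebar * (dl M + dl M)) => // M.
rewrite geq_max => /andP[MM1 MM2] gamma gp; have M0 := leq_trans M11 MM1.
have e1 := eps1 gamma gp; have e0 := eps_ge0 gamma gp.
(* Since eps / (1 + eps) <= eps = ebar min(gamma, 1/gamma), the loss is at most 2 ebar dl times this
   minimum, which dictates [lbarM]. *)
have le : (lbar - ebar * (dl M + dl M)) * Num.min gamma gamma^-1 <=
    (ltilde gamma - eps gamma * (dl M + dl M)) / (1 + eps gamma).
  rewrite [leRHS]mulrBl -/(lambda gamma) mulrBl lerB ?lambda_ge//.
  rewrite [leRHS]mulrAC -/(eps gamma) ler_pdivrMr// ler_peMr//; last by rewrite lerDl.
  by rewrite mulr_ge0// addr_ge0.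
(* Positivity of the minorant gives that of [lhat], hence the gap that [bound] requires, for every
   gamma at once. *)
have lp := lt_le_trans (mulr_gt0 (gap M MM2) (min_gt0 _ gp)) le.
split=> //; apply: bound => //; [exact: rg|exact: tr|].
by move: lp; rewrite pmulr_lgt0 ?invr_gt0.
Qed.
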